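(* Let $E^0_{\cong}$ be the isomorphism problem for the class of computable equivalence structures with no infinite equivalence classes: its field is the set of indices $e$ such that $\varphi_e$ is the characteristic function of an equivalence relation on $\omega$ all of whose classes are finite, and for such $i,j$, $i\,E^0_{\cong}\,j$ iff the two equivalence structures are isomorphic. Then $E^0_{\cong}$ is $\Pi^0_3$-complete under finitary reducibility $\leq_c^{<\omega}$ (among $\Pi^0_3$ equivalence relations); indeed, $E^1_=\leq_cE^0_{\cong}$, where $i\,E^1_=\,j\iff W_i^{\emptyset'}=W_j^{\emptyset'}$.
   Context: An equivalence structure is an equivalence relation on the domain $\omega$; two are isomorphic if there is a bijection of $\omega$ carrying one relation onto the other. $W_e^{\emptyset'}$ is the $e$-th set c.e. in $\emptyset'$. $E\leq_cF$ means there is a total computable $g$ with $x\,E\,y\iff g(x)\,F\,g(y)$ for all $x,y$ in the field of $E$ (and $g$ maps into the field of $F$). $E\leq_c^{<\omega}F$ means there is one computable function which, given $n\ge1$ and an $n$-tuple $(x_0,\dots,x_{n-1})$, outputs an $n$-tuple $(y_0,\dots,y_{n-1})$ with $x_i\,E\,x_j\iff y_i\,F\,y_j$ for all $i<j<n$. *)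

(* Defs.v *)
From mathcomp Require Import all_boot.
Set Implicit Arguments. Unset Strict Implicit. Unset Printing Implicit Defensive.

Inductive prog : Type :=
| PZero
| PSucc
| PProj of nat
| PComp of prog & progs
| PPrec of prog & prog
| PMu of prog
| POracle
with progs : Type :=
| PNil
| PCons of prog & progs.

(* Big-step semantics relative to an oracle A (a set of naturals).
   Arguments are a list; missing arguments default to 0. *)
Inductive evalP (A : nat -> Prop) : prog -> seq nat -> nat -> Prop :=
| eZero xs : evalP A PZero xs 0
| eSucc xs : evalP A PSucc xs (head 0 xs).+1
| eProj i xs : evalP A (PProj i) xs (nth 0 xs i)
| eComp f gs xs ys y :
    evalL A gs xs ys -> evalP A f ys y -> evalP A (PComp f gs) xs y
| ePrec0 f g xs y : evalP A f xs y -> evalP A (PPrec f g) (0 :: xs) y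
| ePrecS f g n xs z y :
    evalP A (PPrec f g) (n :: xs) z -> evalP A g (n :: z :: xs) y ->
    evalP A (PPrec f g) (n.+1 :: xs) y
| eMu f xs n :
    evalP A f (n :: xs) 0 ->
    (forall m, m < n -> exists k, evalP A f (m :: xs) k.+1) ->
    evalP A (PMu f) xs n
| eOracleT xs : A (head 0 xs) -> evalP A POracle xs 1
| eOracleF xs : ~ A (head 0 xs) -> evalP A POracle xs 0
with evalL (A : nat -> Prop) : progs -> seq nat -> seq nat -> Prop :=
| eNil xs : evalL A PNil xs [::]
| eCons p ps xs y ys :
    evalP A p xs y -> evalL A ps xs ys -> evalL A (PCons p ps) xs (y :: ys).

Fixpoint enc (p : prog) : GenTree.tree nat :=
  match p with
  | PZero => GenTree.Node 0 [::]
  | PSucc => GenTree.Node 1 [::]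
  | PProj i => GenTree.Node 2 [:: GenTree.Leaf i]
  | PComp f gs => GenTree.Node 3 [:: enc f; encs gs]
  | PPrec f g => GenTree.Node 4 [:: enc f; enc g]
  | PMu f => GenTree.Node 5 [:: enc f]
  | POracle => GenTree.Node 6 [::]
  end
with encs (ps : progs) : GenTree.tree nat :=
  match ps with
  | PNil => GenTree.Node 7 [::]
  | PCons p ps => GenTree.Node 8 [:: enc p; encs ps]
  end.

Fixpoint dec (t : GenTree.tree nat) : option prog :=
  match t with
  | GenTree.Node 0 [::] => Some PZero
  | GenTree.Node 1 [::] => Some PSucc
  | GenTree.Node 2 [:: GenTree.Leaf i] => Some (PProj i)
  | GenTree.Node 3 [:: t1; t2] =>
      match dec t1, decs t2 with Some f, Some gs => Some (PComp f gs) | _, _ => None end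
  | GenTree.Node 4 [:: t1; t2] =>
      match dec t1, dec t2 with Some f, Some g => Some (PPrec f g) | _, _ => None end
  | GenTree.Node 5 [:: t1] =>
      match dec t1 with Some f => Some (PMu f) | _ => None end
  | GenTree.Node 6 [::] => Some POracle
  | _ => None
  end
with decs (t : GenTree.tree nat) : option progs :=
  match t with
  | GenTree.Node 7 [::] => Some PNil
  | GenTree.Node 8 [:: t1; t2] =>
      match dec t1, decs t2 with Some p, Some ps => Some (PCons p ps) | _, _ => None end
  | _ => None
  end.

Scheme prog_ind2 := Induction for prog Sort Prop
with progs_ind2 := Induction for progs Sort Prop.

Lemma dec_enc_all :
  (forall p, dec (enc p) = Some p) /\ (forall ps, decs (encs ps) = Some ps).
Proof.
split; [apply: (@prog_ind2 (fun p => dec (enc p) = Some p)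
                            (fun ps => decs (encs ps) = Some ps))
       | apply: (@progs_ind2 (fun p => dec (enc p) = Some p)
                            (fun ps => decs (encs ps) = Some ps))];
  by move=> //= *; repeat match goal with H : _ = Some _ |- _ => rewrite H end.
Qed.

(* The e-th program; codes that do not decode default to PZero. *)
Definition prog_of (e : nat) : prog :=
  match @unpickle (GenTree.tree nat) e with
  | Some t => odflt PZero (dec t)
  | None => PZero
  end.

Lemma prog_of_surj p : exists e, prog_of e = p.
Proof.
exists (pickle (enc p)); rewrite /prog_of pickleK.
by rewrite (proj1 dec_enc_all).
Qed.

Definition phiA (A : nat -> Prop) (e x y : nat) : Prop := evalP A (prog_of e) [:: x] y.
Definition emptyset : nat -> Prop := fun _ => False.
Definition phi (e x y : nat) : Prop := phiA emptyset e x y.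
Definition jump0 : nat -> Prop := fun e => exists y, phi e e y.
Definition W' (e : nat) : nat -> Prop := fun x => exists y, phiA jump0 e x y.

Definition total_computable (g : nat -> nat) : Prop := exists e, forall x, phi e x (g x).

Definition computable_pred (P : seq nat -> Prop) : Prop :=
  exists e, forall s, (P s -> phi e (pickle s) 1) /\ (~ P s -> phi e (pickle s) 0).

Definition Pi03_rel (R : nat -> nat -> Prop) : Prop :=
  exists P, computable_pred P /\
    forall x y, R x y <-> forall a, exists b, forall c, P [:: x; y; a; b; c].

Definition cpair (x y : nat) : nat := ((x + y) * (x + y).+1)./2 + y.

Definition is_equiv_rel (R : nat -> nat -> Prop) : Prop :=
  (forall x, R x x) /\ (forall x y, R x y -> R y x) /\
  (forall x y z, R x y -> R y z -> R x z).

Definition eqstr (e : nat) : nat -> nat -> Prop := fun x y => phi e (cpair x y) 1.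

Definition E0_field (e : nat) : Prop :=
  (forall x y, phi e (cpair x y) 0 \/ phi e (cpair x y) 1) /\
  is_equiv_rel (eqstr e) /\
  (forall x, exists s : seq nat, forall y, eqstr e x y -> y \in s).

Definition isomorphic (R S : nat -> nat -> Prop) : Prop :=
  exists f : nat -> nat, bijective f /\ forall x y, R x y <-> S (f x) (f y).

Definition E0_iso (i j : nat) : Prop := isomorphic (eqstr i) (eqstr j).

Definition E1_eq (i j : nat) : Prop := forall x, W' i x <-> W' j x.

Definition c_reducible (DE : nat -> Prop) (E : nat -> nat -> Prop)
                       (DF : nat -> Prop) (F : nat -> nat -> Prop) : Prop :=
  exists g, total_computable g /\ (forall x, DE x -> DF (g x)) /\
    forall x y, DE x -> DE y -> (E x y <-> F (g x) (g y)).

Definition fin_reducible (DE : nat -> Prop) (E : nat -> nat -> Prop)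
                         (DF : nat -> Prop) (F : nat -> nat -> Prop) : Prop :=
  exists e, forall xs : seq nat, 0 < size xs -> (forall x, x \in xs -> DE x) ->
    exists ys : seq nat, phi e (pickle xs) (pickle ys) /\ size ys = size xs /\
      (forall y, y \in ys -> DF y) /\
      forall i j, i < j < size xs ->
        (E (nth 0 xs i) (nth 0 xs j) <-> F (nth 0 ys i) (nth 0 ys j)).

(* Main.v *)
(* Two equivalence structures all of whose classes are finite are isomorphic iff,
   for all n and k, both or neither have at least k classes of size n. "At least k
   classes of size n" is Sigma^0_2, so isomorphism, like membership in the field, is
   Pi^0_3. Uniform computability of phi is obtained without an interpreter: a
   derivation of the big-step semantics is a list of judgements each justified by
   its tail, and checking such a list is computable.

   For hardness, let Q(e, x) <-> exists a, forall b, f(e, x, a, b). The structure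
   built from e has, for each x and a, infinitely many classes of size 2x+2 that
   grow to size 2x+3 as soon as some b refutes a, besides infinitely many classes of
   size 1 and of each size 2x+3. Hence its isomorphism type determines and is
   determined by {x | Q(e, x)}. Taking Q(e, x) := (x is in W_e^{0'}) gives the
   reduction from E^1_=.

   For a Pi^0_3 equivalence relation R, with R x y <-> forall a, S(x, y, a) and S
   Sigma^0_2, and a tuple x_0, ..., x_{n-1}, let G_a be the graph on the indices with
   an edge (p, q) when S(x_p, x_q, a') for all a' <= a. Assign to k the Sigma^0_2 set
   of pairs (i, a) such that k is connected to i in G_a. R-related indices are
   adjacent in every G_a, hence get the same set; for large a the edges of G_a are
   exactly the R-related pairs, hence unrelated indices get different sets. *)

Require Import Defs.
From mathcomp Require Import all_boot.
From mathcomp Require Import boolp.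
From mathcomp Require Import zify.
Set Implicit Arguments. Unset Strict Implicit. Unset Printing Implicit Defensive.

(** * Induction on evaluations and determinism *)

(* The principle Rocq generates has no induction hypothesis below the
   existential quantifier in eMu. *)
Lemma evalP_mutual_ind (A : nat -> Prop) (P : prog -> seq nat -> nat -> Prop)
    (Q : progs -> seq nat -> seq nat -> Prop) :
  (forall xs, P PZero xs 0) ->
  (forall xs, P PSucc xs (head 0 xs).+1) ->
  (forall i xs, P (PProj i) xs (nth 0 xs i)) ->
  (forall f gs xs ys y, Q gs xs ys -> P f ys y -> P (PComp f gs) xs y) ->
  (forall f g xs y, P f xs y -> P (PPrec f g) (0 :: xs) y) ->
  (forall f g n xs z y, P (PPrec f g) (n :: xs) z -> P g (n :: z :: xs) y ->
     P (PPrec f g) (n.+1 :: xs) y) ->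
  (forall f xs n, P f (n :: xs) 0 ->
     (forall m, m < n -> exists k, P f (m :: xs) k.+1) -> P (PMu f) xs n) ->
  (forall xs, A (head 0 xs) -> P POracle xs 1) ->
  (forall xs, ~ A (head 0 xs) -> P POracle xs 0) ->
  (forall xs, Q PNil xs [::]) ->
  (forall p ps xs y ys, P p xs y -> Q ps xs ys -> Q (PCons p ps) xs (y :: ys)) ->
  (forall p xs y, evalP A p xs y -> P p xs y) /\
  (forall ps xs ys, evalL A ps xs ys -> Q ps xs ys).
Proof.
move=> h0 h1 h2 h3 h4 h5 h6 h7 h8 h9 h10.
have aux : forall p xs y (H : evalP A p xs y), P p xs y.
  fix IHP 4 with (IHL ps xs ys (H : evalL A ps xs ys) {struct H} : Q ps xs ys).
    move=> p xs y [] {p xs y}.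
    - exact: h0.
    - exact: h1.
    - exact: h2.
    - by move=> f gs xs ys y /IHL Hg /IHP; apply: h3.
    - by move=> f g xs y /IHP; apply: h4.
    - by move=> f g n xs z y /IHP H1 /IHP; apply: h5.
    - move=> f xs n /IHP H1 H2; apply: h6 => // m /H2 [k Hk].
      by exists k; apply: IHP.
    - exact: h7.
    - exact: h8.
  move=> ps xs ys [] {ps xs ys} => [xs|p ps xs y ys H1 H2]; first exact: h9.
  by apply: h10; [apply: IHP | apply: IHL].
split=> // ps xs ys; elim=> {ps xs ys} [xs|p ps xs y ys H1 H2 H3]; first exact: h9.
by apply: h10 => //; apply: aux.
Qed.

Lemma evalP_functional A p xs y : evalP A p xs y -> forall z, evalP A p xs z -> y = z.
Proof.
move: p xs y.
have [] // := @evalP_mutual_ind A (fun p xs y => forall z, evalP A p xs z -> y = z)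
  (fun ps xs ys => forall zs, evalL A ps xs zs -> ys = zs).
- by move=> xs z H; inversion H.
- by move=> xs z H; inversion H.
- by move=> i xs z H; inversion H.
- move=> f gs xs ys y IHg IHf z H; inversion H as [| | |? ? ? zs ? Hg Hf| | | | |]; subst.
  by apply: IHf; rewrite (IHg _ Hg).
- by move=> f g xs y IH z H; inversion H; subst; apply: IH.
- move=> f g n xs z y IH1 IH2 w H; inversion H as [| | | | |? ? ? ? ? ? Hf Hg| | |]; subst.
  by apply: IH2; rewrite (IH1 _ Hf).
- move=> f xs n IH1 IH2 m H; inversion H as [| | | | | |? ? ? Hm Hlt| |]; subst.
  case: (ltngtP n m) => // lt.
    by have [k /IH1] := Hlt _ lt.
  by have [k IH] := IH2 _ lt; have := IH _ Hm.
- by move=> xs H z H'; inversion H'.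
- by move=> xs H z H'; inversion H'.
- by move=> xs zs H; inversion H.
- move=> p ps xs y ys IH1 IH2 zs H; inversion H as [|? ? ? ? ? Hp Hps]; subst.
  by rewrite (IH1 _ Hp) (IH2 _ Hps).
Qed.

(** * Computable functions of a fixed arity *)

Definition cn (n : nat) (f : seq nat -> nat) : Prop :=
  exists p, forall xs, size xs = n -> evalP emptyset p xs (f xs).

Lemma cn_ext n f g : cn n f -> (forall xs, size xs = n -> f xs = g xs) -> cn n g.
Proof. by move=> [p Hp] E; exists p => xs Hx; rewrite -E //; apply: Hp. Qed.

Lemma cn_proj n i : cn n (fun xs => nth 0 xs i).
Proof. by exists (PProj i) => xs _; apply: eProj. Qed.

Fixpoint progs_of (s : seq prog) : progs :=
  if s is p :: s' then PCons p (progs_of s') else PNil.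

Lemma evalL_progs_of (A : nat -> Prop) xs (ps : seq prog) ys :
  size ps = size ys ->
  (forall i, i < size ps -> evalP A (nth PZero ps i) xs (nth 0 ys i)) ->
  evalL A (progs_of ps) xs ys.
Proof.
elim: ps ys => [|p ps IH] [|y ys] //=; first by move=> *; apply: eNil.
move=> [E] H; apply: eCons; first exact: (H 0).
by apply: IH => // i Hi; apply: (H i.+1).
Qed.

Lemma evalL_projs (A : nat -> Prop) xs n : size xs = n ->
  evalL A (progs_of [seq PProj i | i <- iota 0 n]) xs xs.
Proof.
move=> E; apply: evalL_progs_of; rewrite size_map size_iota // => i Hi.
by rewrite (nth_map 0) ?size_iota // nth_iota // add0n; apply: eProj.
Qed.

Lemma cn_comp1 n h a : cn 1 h -> cn n a -> cn n (fun xs => h [:: a xs]).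
Proof.
move=> [p Hp] [q Hq]; exists (PComp p (progs_of [:: q])) => xs Hx.
apply: (@eComp _ _ _ _ [:: a xs]); last exact: Hp.
by apply: evalL_progs_of => // -[|//] _; apply: Hq.
Qed.

Lemma cn_succ n a : cn n a -> cn n (fun xs => (a xs).+1).
Proof.
apply: (@cn_comp1 n (fun xs => (head 0 xs).+1)).
by exists PSucc => xs _; apply: eSucc.
Qed.

Lemma cn_const n k : cn n (fun _ => k).
Proof. by elim: k => [|k /cn_succ //]; exists PZero => xs _; apply: eZero. Qed.

Lemma evalP_prec (A : nat -> Prop) pf pg (f : nat) (g : nat -> nat -> nat) xs k :
  evalP A pf xs f -> (forall i z, evalP A pg (i :: z :: xs) (g i z)) ->
  evalP A (PPrec pf pg) (k :: xs) (iteri k g f).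
Proof. by move=> Hf Hg; elim: k => [|k IH]; [apply: ePrec0 | apply: ePrecS IH _]. Qed.

Lemma cn_iteri n a f (g : seq nat -> nat) : cn n a -> cn n f -> cn n.+2 g ->
  cn n (fun xs => iteri (a xs) (fun k z => g (k :: z :: xs)) (f xs)).
Proof.
move=> [pa Ha] [pf Hf] [pg Hg].
exists (PComp (PPrec pf pg) (PCons pa (progs_of [seq PProj i | i <- iota 0 n]))).
move=> xs Hx; apply: (@eComp _ _ _ _ (a xs :: xs)).
  by apply: eCons; [apply: Ha | apply: evalL_projs].
by apply: evalP_prec; [apply: Hf | move=> i z; apply: Hg; rewrite /= Hx].
Qed.

Lemma cn_mu n (f : seq nat -> nat) h : cn n.+1 f ->
  (forall xs, size xs = n -> f (h xs :: xs) = 0) ->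
  (forall xs m, size xs = n -> m < h xs -> 0 < f (m :: xs)) -> cn n h.
Proof.
move=> [p Hp] H0 H1; exists (PMu p) => xs Hx.
apply: eMu; first by rewrite -(H0 _ Hx); apply: Hp; rewrite /= Hx.
move=> m lt; exists (f (m :: xs)).-1; rewrite prednK; last exact: H1.
by apply: Hp; rewrite /= Hx.
Qed.

Lemma cn_add n a b : cn n a -> cn n b -> cn n (fun xs => a xs + b xs).
Proof.
move=> ca cb.
apply: cn_ext (cn_iteri ca cb (cn_succ (cn_proj n.+2 1))) _ => xs _ /=.
by elim: (a xs) => //= k ->.
Qed.

Lemma cn_mul n a b : cn n a -> cn n b -> cn n (fun xs => a xs * b xs).
Proof.
move=> ca [p Hb].
(* The recursion step sees the counter and the accumulator in front of the parameters, so [b] is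
   re-indexed to skip them. *)
have cb : cn n.+2 (fun xs => b (behead (behead xs))).
  exists (PComp p (progs_of [seq PProj i.+2 | i <- iota 0 n])) => xs Hx.
  case: xs Hx => [|u [|v xs]] // [Hx]; apply: eComp (Hb _ Hx).
  apply: evalL_progs_of; rewrite size_map size_iota // => i Hi.
  by rewrite (nth_map 0) ?size_iota // nth_iota // add0n; apply: eProj.
apply: cn_ext (cn_iteri ca (cn_const n 0) (cn_add cb (cn_proj n.+2 1))) _ => xs _ /=.
by elim: (a xs) => //= k ->; rewrite mulSn.
Qed.

Lemma cn_exp2 n a : cn n a -> cn n (fun xs => 2 ^ a xs).
Proof.
move=> ca.
apply: cn_ext (cn_iteri ca (cn_const n 1)
  (cn_mul (cn_const n.+2 2) (cn_proj n.+2 1))) _ => xs _ /=.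
by elim: (a xs) => //= k ->; rewrite expnS.
Qed.

Lemma cn_pred n a : cn n a -> cn n (fun xs => (a xs).-1).
Proof.
move=> ca; apply: cn_ext (cn_iteri ca (cn_const n 0) (cn_proj n.+2 0)) _ => xs _ /=.
by case: (a xs).
Qed.

Lemma cn_sub n a b : cn n a -> cn n b -> cn n (fun xs => a xs - b xs).
Proof.
move=> ca cb.
apply: cn_ext (cn_iteri cb ca (cn_pred (cn_proj n.+2 1))) _ => xs _ /=.
by elim: (b xs) => [|k /= ->]; rewrite ?subn0 // subnS.
Qed.

Lemma cn_odd n a : cn n a -> cn n (fun xs => odd (a xs)).
Proof.
move=> ca.
apply: cn_ext (cn_iteri ca (cn_const n 0) (cn_sub (cn_const n.+2 1) (cn_proj n.+2 1))) _.
by move=> xs _ /=; elim: (a xs) => //= k ->; case: odd.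
Qed.

Lemma cn_half n a : cn n a -> cn n (fun xs => (a xs)./2).
Proof.
move=> ca.
apply: cn_ext (cn_iteri ca (cn_const n 0) (cn_add (cn_odd (cn_proj n.+2 0)) (cn_proj n.+2 1))) _.
by move=> xs _ /=; elim: (a xs) => //= k ->; rewrite uphalf_half.
Qed.

Lemma cn_iter_half n a b : cn n a -> cn n b -> cn n (fun xs => iter (a xs) half (b xs)).
Proof.
move=> ca cb; apply: cn_ext (cn_iteri ca cb (cn_half (cn_proj n.+2 1))) _ => xs _ /=.
by elim: (a xs) => //= k ->.
Qed.

(** * Head, tail and cons on coded lists *)

Definition code_head (c : nat) : nat := head 0 (CodeSeq.decode c).
Definition code_tail (c : nat) : nat := CodeSeq.code (behead (CodeSeq.decode c)).

Lemma iter_half_code v m k : k <= v -> iter k half (2 ^ v * m) = 2 ^ (v - k) * m.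
Proof.
elim: k => [|k IH] lt; first by rewrite subn0.
rewrite iterS IH; last exact: ltnW.
by rewrite (_ : v - k = (v - k.+1).+1) ?expnS -?mulnA ?mul2n ?doubleK //; lia.
Qed.

(** The code of v :: s is 2^v (2c + 1), where c codes s. The head is therefore the 2-adic valuation,
    and halving once more after v halvings yields c. *)
Lemma cn_code_head n a : cn n a -> cn n (fun xs => code_head (a xs)).
Proof.
apply: (@cn_comp1 n (fun xs => code_head (nth 0 xs 0))).
(* The search is for the least number of halvings that leaves an odd number; the outer factor makes
   it stop at 0 on the code 0 of the empty list. *)
apply: (@cn_mu 1 (fun xs => nth 0 xs 1 * (1 - odd (iter (nth 0 xs 0) half (nth 0 xs 1))))).
- apply: cn_mul; first exact: cn_proj.
  apply: cn_sub; first exact: cn_const.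
  by apply: cn_odd; apply: cn_iter_half; apply: cn_proj.
- move=> [|c []] //= _; rewrite -[c]CodeSeq.decodeK /code_head CodeSeq.codeK.
  case: (CodeSeq.decode c) => [|v s] //=.
  by rewrite iter_half_code // subnn mul1n /= odd_double /= muln0.
- move=> [|c []] //= m _; rewrite -[c]CodeSeq.decodeK /code_head CodeSeq.codeK.
  case: (CodeSeq.decode c) => [|v s] //= lt.
  rewrite iter_half_code; last exact: ltnW.
  rewrite !muln_gt0 expn_gt0 /= subn_gt0.
  by rewrite oddM oddX /=; case: (v - m) (subn_gt0 m v) lt => [<-|].
Qed.

Lemma cn_code_tail n a : cn n a -> cn n (fun xs => code_tail (a xs)).
Proof.
move=> ca; apply: cn_ext (cn_half (cn_iter_half (cn_code_head ca) ca)) _ => xs _.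
rewrite /code_head /code_tail -[a xs]CodeSeq.decodeK CodeSeq.codeK.
case: (CodeSeq.decode _) => [|v s] //=.
rewrite iter_half_code // subnn mul1n /= uphalf_double //.
Qed.

Lemma cn_code_cons n a b : cn n a -> cn n b -> cn n (fun xs => 2 ^ a xs * (b xs).*2.+1).
Proof.
move=> ca cb.
apply: cn_ext (cn_mul (cn_exp2 ca) (cn_succ (cn_mul (cn_const n 2) cb))) _ => xs _ /=.
by rewrite mul2n.
Qed.

(** * Computable functions between countable types *)

(** Nothing is asked of the program on numbers that are not codes of elements of [X], so it may
    diverge there. *)
Definition cmp (X Y : countType) (f : X -> Y) : Prop :=
  exists p, forall x, evalP emptyset p [:: pickle x] (pickle (f x)).

Lemma cmp_ext (X Y : countType) (f g : X -> Y) : cmp f -> f =1 g -> cmp g.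
Proof. by move=> [p Hp] E; exists p => x; rewrite -E. Qed.

(** Allows a change of codomain that leaves the codes alone, such as from Booleans to numbers or
    from a list of numbers to its code. *)
Lemma cmp_code (X Y Z : countType) (f : X -> Y) (g : X -> Z) :
  cmp f -> (forall x, pickle (g x) = pickle (f x)) -> cmp g.
Proof. by move=> [p Hp] E; exists p => x; rewrite E. Qed.

Lemma cmp_id (X : countType) : cmp (fun x : X => x).
Proof. by exists (PProj 0) => x; apply: (eProj _ 0 [:: _]). Qed.

Lemma cmp_cn1 (X Y Z : countType) h (a : X -> Y) (f : X -> Z) :
  cn 1 h -> cmp a -> (forall x, pickle (f x) = h [:: pickle (a x)]) -> cmp f.
Proof.
move=> [p Hp] [q Hq] E; exists (PComp p (progs_of [:: q])) => x; rewrite E.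
apply: (@eComp _ _ _ _ [:: pickle (a x)]); last exact: Hp.
by apply: evalL_progs_of => // -[|//].
Qed.

Lemma cmp_cn2 (X Y1 Y2 Z : countType) h (a : X -> Y1) (b : X -> Y2) (f : X -> Z) :
  cn 2 h -> cmp a -> cmp b ->
  (forall x, pickle (f x) = h [:: pickle (a x); pickle (b x)]) -> cmp f.
Proof.
move=> [p Hp] [q Hq] [r Hr] E; exists (PComp p (progs_of [:: q; r])) => x; rewrite E.
apply: (@eComp _ _ _ _ [:: pickle (a x); pickle (b x)]); last exact: Hp.
by apply: evalL_progs_of => // -[|[|//]].
Qed.

Lemma cmp_cn3 (X Y1 Y2 Y3 Z : countType) h (a : X -> Y1) (b : X -> Y2) (c : X -> Y3)
    (f : X -> Z) :
  cn 3 h -> cmp a -> cmp b -> cmp c ->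
  (forall x, pickle (f x) = h [:: pickle (a x); pickle (b x); pickle (c x)]) -> cmp f.
Proof.
move=> [p Hp] [q Hq] [r Hr] [s Hs] E.
exists (PComp p (progs_of [:: q; r; s])) => x; rewrite E.
apply: (@eComp _ _ _ _ [:: pickle (a x); pickle (b x); pickle (c x)]); last exact: Hp.
by apply: evalL_progs_of => // -[|[|[|//]]].
Qed.

Lemma cmp_const (X Y : countType) (c : Y) : cmp (fun _ : X => c).
Proof. exact: cmp_cn1 (cn_const 1 (pickle c)) (@cmp_id X) _. Qed.

Lemma cmp_comp (X Y Z : countType) (f : Y -> Z) (g : X -> Y) :
  cmp f -> cmp g -> cmp (fun x => f (g x)).
Proof.
move=> [p Hp] [q Hq]; exists (PComp p (progs_of [:: q])) => x.
apply: (@eComp _ _ _ _ [:: pickle (g x)]); last exact: Hp.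
by apply: evalL_progs_of => // -[|//].
Qed.

Lemma cn_pair n a b : cn n a -> cn n b -> cn n (fun xs => CodeSeq.code [:: a xs; b xs]).
Proof. by move=> ca cb; do !apply: cn_code_cons => //; apply: cn_const. Qed.

Lemma pickle_pair (X Y : countType) (p : X * Y) :
  pickle p = CodeSeq.code [:: pickle p.1; pickle p.2].
Proof. by []. Qed.

Lemma pickle_cons (T : countType) (x : T) s :
  pickle (x :: s) = 2 ^ pickle x * (pickle s).*2.+1.
Proof. by []. Qed.

Lemma cmp_pair (X Y Z : countType) (a : X -> Y) (b : X -> Z) :
  cmp a -> cmp b -> cmp (fun x => (a x, b x)).
Proof.
by move=> ca cb; apply: cmp_cn2 (cn_pair (cn_proj 2 0) (cn_proj 2 1)) ca cb _.
Qed.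

Lemma cmp_fst (X Y Z : countType) (a : X -> Y * Z) : cmp a -> cmp (fun x => (a x).1).
Proof.
move=> ca; apply: cmp_cn1 (cn_code_head (cn_proj 1 0)) ca _ => x.
by rewrite [nth _ _ _]/= pickle_pair /code_head CodeSeq.codeK.
Qed.

Lemma cmp_snd (X Y Z : countType) (a : X -> Y * Z) : cmp a -> cmp (fun x => (a x).2).
Proof.
move=> ca; apply: cmp_cn1 (cn_code_head (cn_code_tail (cn_proj 1 0))) ca _ => x.
by rewrite [nth _ _ _]/= pickle_pair /code_head /code_tail !CodeSeq.codeK.
Qed.

Lemma cmp_iteri (X Y : countType) (n : X -> nat) (z : X -> Y) (s : X -> nat -> Y -> Y) :
  cmp n -> cmp z -> cmp (fun p : X * (nat * Y) => s p.1 p.2.1 p.2.2) ->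
  cmp (fun x => iteri (n x) (s x) (z x)).
Proof.
move=> [pn Hn] [pz Hz] [ps Hs].
(* [pp] turns the arguments k, z, x of the recursion step into the code of (x, (k, z)). *)
have [pp Hpp] := cn_pair (cn_proj 3 2) (cn_pair (cn_proj 3 0) (cn_proj 3 1)).
pose pr := PPrec pz (PComp ps (progs_of [:: pp])).
exists (PComp pr (progs_of [:: pn; PProj 0])) => x.
apply: (@eComp _ _ _ _ [:: n x; pickle x]).
  by apply: evalL_progs_of => // -[|[|//]] _; [apply: Hn | apply: (eProj _ 0 [:: _])].
elim: (n x) => [|k IH] /=; first exact: ePrec0.
apply: ePrecS IH _; apply: (@eComp _ _ _ _ [:: pickle (x, (k, iteri k (s x) (z x)))]).
  by apply: evalL_progs_of => // -[|//] _; apply: (Hpp [:: _; _; _]).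
exact: Hs.
Qed.

Lemma cmp_iter (X Y : countType) (n : X -> nat) (z : X -> Y) (s : X -> Y -> Y) :
  cmp n -> cmp z -> cmp (fun p : X * Y => s p.1 p.2) ->
  cmp (fun x => iter (n x) (s x) (z x)).
Proof.
move=> cn cz cs; apply: (cmp_ext (f := fun x => iteri (n x) (fun _ => s x) (z x))).
  apply: cmp_iteri => //; apply: (cmp_comp (f := fun p => s p.1 p.2)
    (g := fun p : X * (nat * Y) => (p.1, p.2.2))) => //.
  by apply: cmp_pair; [apply/cmp_fst/cmp_id | apply/cmp_snd/cmp_snd/cmp_id].
by move=> x; elim: (n x) => //= k ->.
Qed.

(** * Closure of computability under arithmetic and Boolean operations *)

Section Arith.
Variable X : countType.
Implicit Types (a b : X -> nat) (p q : X -> bool).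

Lemma cmp_succ a : cmp a -> cmp (fun x => (a x).+1).
Proof. by move=> ca; apply: cmp_cn1 (cn_succ (cn_proj 1 0)) ca _. Qed.

Lemma cmp_pred a : cmp a -> cmp (fun x => (a x).-1).
Proof. by move=> ca; apply: cmp_cn1 (cn_pred (cn_proj 1 0)) ca _. Qed.

Lemma cmp_half a : cmp a -> cmp (fun x => (a x)./2).
Proof. by move=> ca; apply: cmp_cn1 (cn_half (cn_proj 1 0)) ca _. Qed.

Lemma cmp_add a b : cmp a -> cmp b -> cmp (fun x => a x + b x).
Proof. by move=> ca cb; apply: cmp_cn2 (cn_add (cn_proj 2 0) (cn_proj 2 1)) ca cb _. Qed.

Lemma cmp_sub a b : cmp a -> cmp b -> cmp (fun x => a x - b x).
Proof. by move=> ca cb; apply: cmp_cn2 (cn_sub (cn_proj 2 0) (cn_proj 2 1)) ca cb _. Qed.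

Lemma cmp_mul a b : cmp a -> cmp b -> cmp (fun x => a x * b x).
Proof. by move=> ca cb; apply: cmp_cn2 (cn_mul (cn_proj 2 0) (cn_proj 2 1)) ca cb _. Qed.

(** On codes the conditional is p f + (1 - p) g. Both branches get evaluated, which is harmless
    because both are total. *)
Lemma cmp_if (Y : countType) p (f g : X -> Y) :
  cmp p -> cmp f -> cmp g -> cmp (fun x => if p x then f x else g x).
Proof.
move=> cp cf cg.
apply: cmp_cn3 (cn_add (cn_mul (cn_proj 3 0) (cn_proj 3 1))
  (cn_mul (cn_sub (cn_const 3 1) (cn_proj 3 0)) (cn_proj 3 2))) cp cf cg _ => x /=.
have -> (c : bool) : pickle c = nat_of_bool c by [].
by case: (p x); rewrite /= ?mul1n ?addn0.
Qed.

Lemma cmp_leq a b : cmp a -> cmp b -> cmp (fun x => a x <= b x).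
Proof.
move=> ca cb; apply: cmp_cn2 (cn_sub (cn_const 2 1)
  (cn_sub (cn_proj 2 0) (cn_proj 2 1))) ca cb _ => x /=.
have -> (c : bool) : pickle c = nat_of_bool c by [].
have -> (c : nat) : pickle c = c by [].
by rewrite /leq; case: (a x - b x).
Qed.

Lemma cmp_eq (Y : countType) (f g : X -> Y) : cmp f -> cmp g -> cmp (fun x => f x == g x).
Proof.
move=> ca cb; apply: cmp_cn2 (cn_sub (cn_const 2 1) (cn_add
  (cn_sub (cn_proj 2 0) (cn_proj 2 1)) (cn_sub (cn_proj 2 1) (cn_proj 2 0)))) ca cb _ => x /=.
have -> (c : bool) : pickle c = nat_of_bool c by [].
rewrite -(inj_eq (pcan_inj (@pickleK Y))); case: ltngtP => H /=; lia.
Qed.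

Lemma cmp_and p q : cmp p -> cmp q -> cmp (fun x => p x && q x).
Proof. by move=> *; apply: cmp_if => //; apply: cmp_const. Qed.

Lemma cmp_or p q : cmp p -> cmp q -> cmp (fun x => p x || q x).
Proof. by move=> *; apply: cmp_if => //; apply: cmp_const. Qed.

Lemma cmp_not p : cmp p -> cmp (fun x => ~~ p x).
Proof. by move=> *; apply: cmp_if => //; apply: cmp_const. Qed.

Lemma cmp_nat_of_bool p : cmp p -> cmp (fun x => nat_of_bool (p x)).
Proof. by move=> cp; apply: cmp_code cp _. Qed.
End Arith.

Lemma cmp_pickle (X Y : countType) (f : X -> Y) : cmp f -> cmp (fun x => pickle (f x)).
Proof. by move=> cf; apply: cmp_code cf _. Qed.

Lemma pickle_seq_nat (s : seq nat) : pickle s = CodeSeq.code s.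
Proof. by rewrite /pickle /= /pickle_seq map_id. Qed.

Lemma cmp_code_seq (X : countType) (f : X -> seq nat) :
  cmp f -> cmp (fun x => CodeSeq.code (f x)).
Proof. by move=> cf; apply: cmp_code cf _ => x; rewrite pickle_seq_nat. Qed.

Lemma cmp_decode_seq (X : countType) (f : X -> nat) :
  cmp f -> cmp (fun x => CodeSeq.decode (f x)).
Proof.
by move=> cf; apply: cmp_code cf _ => x; rewrite pickle_seq_nat CodeSeq.decodeK.
Qed.

Lemma cmp_cons (X T : countType) (a : X -> T) (s : X -> seq T) :
  cmp a -> cmp s -> cmp (fun x => a x :: s x).
Proof.
by move=> ca cs; apply: cmp_cn2 (cn_code_cons (cn_proj 2 0) (cn_proj 2 1)) ca cs _.
Qed.

Lemma code_head_pickle (T : countType) (x : T) s : code_head (pickle (x :: s)) = pickle x.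
Proof. by rewrite /code_head /pickle /= /pickle_seq CodeSeq.codeK. Qed.

Lemma code_tail_pickle (T : countType) (x : T) s : code_tail (pickle (x :: s)) = pickle s.
Proof. by rewrite /code_tail /pickle /= /pickle_seq CodeSeq.codeK. Qed.

(* The branch [f] may diverge on codes of the empty list; PPrec evaluates its step
   program only for a nonzero recursion argument, which makes the case lazy. *)
Lemma cmp_case_seq (X T Y : countType) (s : X -> seq T) (z : X -> Y) (f : X -> T -> seq T -> Y) :
  cmp s -> cmp z -> cmp (fun p : X * (T * seq T) => f p.1 p.2.1 p.2.2) ->
  cmp (fun x => if s x is a :: s' then f x a s' else z x).
Proof.
move=> [ps Hs] [pz Hz] [pf Hf].
have [pp Hpp] := cn_pair (cn_proj 4 2) (cn_pair (cn_code_head (cn_proj 4 3))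
  (cn_code_tail (cn_proj 4 3))).
have [pb Hb] := cn_sub (cn_const 1 1) (cn_sub (cn_const 1 1) (cn_proj 1 0)).
pose pr := PPrec (PComp pz (progs_of [:: PProj 0])) (PComp pf (progs_of [:: pp])).
exists (PComp pr (progs_of [:: PComp pb (progs_of [:: ps]); PProj 0; ps])) => x.
apply: (@eComp _ _ _ _ [:: 1 - (1 - pickle (s x)); pickle x; pickle (s x)]).
  apply: evalL_progs_of => // -[|[|[|//]]] _; last exact: Hs.
    apply: (@eComp _ _ _ _ [:: pickle (s x)]); last exact: (Hb [:: _]).
    by apply: evalL_progs_of => // -[|//] _; apply: Hs.
  exact: (eProj _ 0 [:: _]).
have Hz' : evalP emptyset (PComp pz (progs_of [:: PProj 0])) [:: pickle x; pickle (s x)]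
    (pickle (z x)).
  apply: (@eComp _ _ _ _ [:: pickle x]) => //.
  by apply: evalL_progs_of => // -[|//] _; apply: (eProj _ 0 [:: _; _]).
move: Hz'; case: (s x) => [|a s'] Hz'; first exact: (ePrec0 _ Hz').
have -> : 1 - (1 - pickle (a :: s')) = 1 by rewrite pickle_cons; lia.
apply: (ePrecS (ePrec0 _ Hz')).
apply: (@eComp _ _ _ _ [:: pickle (x, (a, s'))]); last exact: Hf.
apply: evalL_progs_of => // -[|//] _.
have /= := Hpp [:: 0; pickle (z x); pickle x; pickle (a :: s')].
by rewrite code_head_pickle code_tail_pickle; apply.
Qed.

Ltac cmp_ext_tac := fail.

Ltac cmp_basic :=
  match goal with
  | |- cmp (fun x => x) => apply: cmp_id
  | |- cmp (fun _ => ?c) => apply: cmp_const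
  | |- cmp (fun x => (_, _)) => apply: cmp_pair
  | |- cmp (fun x => fst _) => apply: cmp_fst
  | |- cmp (fun x => snd _) => apply: cmp_snd
  | |- cmp (fun x => let (a, _) := _ in a) => apply: cmp_fst
  | |- cmp (fun x => let (_, b) := _ in b) => apply: cmp_snd
  | |- cmp (fun x => _.+1) => apply: cmp_succ
  | |- cmp (fun x => _.-1) => apply: cmp_pred
  | |- cmp (fun x => _./2) => apply: cmp_half
  | |- cmp (fun x => _ + _) => apply: cmp_add
  | |- cmp (fun x => _ - _) => apply: cmp_sub
  | |- cmp (fun x => _ * _) => apply: cmp_mul
  | |- cmp (fun x => _ <= _) => apply: cmp_leq
  | |- cmp (fun x => _ == _) => apply: cmp_eq
  | |- cmp (fun x => _ && _) => apply: cmp_and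
  | |- cmp (fun x => _ || _) => apply: cmp_or
  | |- cmp (fun x => ~~ _) => apply: cmp_not
  | |- cmp (fun x => nat_of_bool _) => apply: cmp_nat_of_bool
  | |- cmp (fun x => CodeSeq.code _) => apply: cmp_code_seq
  | |- cmp (fun x => CodeSeq.decode _) => apply: cmp_decode_seq
  | |- cmp (fun x => pickle _) => apply: cmp_pickle
  | |- cmp (fun x => _ :: _) => apply: cmp_cons
  | |- cmp (fun x => iteri _ _ _) => apply: cmp_iteri
  | |- cmp (fun x => iter _ _ _) => apply: cmp_iter
  | |- cmp (fun x => if _ then _ else _) => apply: cmp_if
  end.

Ltac cmp_eta :=
  match goal with
  | |- cmp (fun _ => _) => idtac
  | |- @cmp ?X ?Y ?f => change (@cmp X Y (fun x => f x))
  end.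

Ltac cmp_tac :=
  repeat (cbv beta zeta; first [assumption | cmp_eta; first [cmp_basic | cmp_ext_tac]]).

(** * Closure of computability under list operations *)

Section Lists.
Variables (X T Y : countType).
Implicit Types (s : X -> seq T).

Lemma cmp_behead s : cmp s -> cmp (fun x => behead (s x)).
Proof. by move=> cs; apply: cmp_case_seq => //; cmp_tac. Qed.

Lemma cmp_head (d : X -> T) s : cmp d -> cmp s -> cmp (fun x => head (d x) (s x)).
Proof. by move=> cd cs; apply: cmp_case_seq => //; cmp_tac. Qed.

(** Bounds the number of iterations of a fold by the code of the list, before the length itself is
    known to be computable. *)
Lemma size_pickle (s : seq T) : size s <= pickle s.
Proof.
elim: s => // a s IH; rewrite pickle_cons.
have : 0 < 2 ^ pickle a by rewrite expn_gt0.
move: (2 ^ _) IH => k /=; nia.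
Qed.

Lemma cmp_foldl s (z : X -> Y) (f : X -> Y -> T -> Y) :
  cmp s -> cmp z -> cmp (fun p : X * (Y * T) => f p.1 p.2.1 p.2.2) ->
  cmp (fun x => foldl (f x) (z x) (s x)).
Proof.
move=> cs cz cf.
(* The state is the accumulator with the rest of the list; surplus iterations find the rest empty
   and change nothing. *)
pose step x (st : Y * seq T) := if st.2 is a :: s' then (f x st.1 a, s') else st.
apply: (cmp_ext (f := fun x => (iter (pickle (s x)) (step x) (z x, s x)).1)); last first.
  move=> x; move: (pickle _) (size_pickle (s x)) => n.
  elim: n (z x) (s x) => [|n IH] y [|a s'] //= lt.
    by rewrite -[LHS]/((step x (iter n (step x) (y, [::]))).1) -iterS iterSr IH.
  by rewrite -iterS iterSr IH.
apply/cmp_fst/cmp_iter; cmp_tac.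
apply: cmp_case_seq; cmp_tac.
by apply: (cmp_comp (g := fun p : X * (Y * seq T) * (T * seq T) => (p.1.1, (p.1.2.1, p.2.1)))
  cf); cmp_tac.
Qed.
End Lists.

Lemma cmp_rev (X T : countType) (s : X -> seq T) : cmp s -> cmp (fun x => rev (s x)).
Proof.
move=> cs; apply: (cmp_ext (f := fun x => foldl (fun r a => a :: r) [::] (s x))).
  by apply: cmp_foldl; cmp_tac.
by move=> x; rewrite /rev; elim: (s x) [::] => //= a l IH r; rewrite IH.
Qed.

Lemma cmp_foldr (X T Y : countType) (s : X -> seq T) (z : X -> Y) (f : X -> T -> Y -> Y) :
  cmp s -> cmp z -> cmp (fun p : X * (T * Y) => f p.1 p.2.1 p.2.2) ->
  cmp (fun x => foldr (f x) (z x) (s x)).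
Proof.
move=> cs cz cf.
apply: (cmp_ext (f := fun x => foldl (fun y a => f x a y) (z x) (rev (s x)))).
  apply: cmp_foldl => //; first exact: cmp_rev.
  by apply: (cmp_comp (g := fun p : X * (Y * T) => (p.1, (p.2.2, p.2.1))) cf); cmp_tac.
by move=> x; rewrite foldl_rev.
Qed.

Section Lists2.
Variables (X T U : countType).
Implicit Types (s : X -> seq T).

Lemma cmp_map s (f : X -> T -> U) : cmp s -> cmp (fun p : X * T => f p.1 p.2) ->
  cmp (fun x => [seq f x a | a <- s x]).
Proof.
move=> cs cf; apply: (cmp_ext (f := fun x => foldr (fun a r => f x a :: r) [::] (s x))).
  apply: cmp_foldr; cmp_tac.
  by apply: (cmp_comp (g := fun p : X * (T * seq U) => (p.1, p.2.1)) cf); cmp_tac.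
by move=> x; elim: (s x) => //= a l ->.
Qed.

Lemma cmp_cat s1 s2 : cmp s1 -> cmp s2 -> cmp (fun x => s1 x ++ s2 x).
Proof.
move=> c1 c2; apply: (cmp_ext (f := fun x => foldr cons (s2 x) (s1 x))).
  by apply: cmp_foldr; cmp_tac.
by move=> x; elim: (s1 x) => //= a l ->.
Qed.

Lemma cmp_rcons s a : cmp s -> cmp a -> cmp (fun x => rcons (s x) (a x)).
Proof.
move=> cs ca; apply: (cmp_ext (f := fun x => s x ++ [:: a x])).
  by apply: cmp_cat; cmp_tac.
by move=> x; rewrite cats1.
Qed.

Lemma cmp_size s : cmp s -> cmp (fun x => size (s x)).
Proof.
move=> cs; apply: (cmp_ext (f := fun x => foldr (fun _ n => n.+1) 0 (s x))).
  by apply: cmp_foldr; cmp_tac.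
by move=> x; elim: (s x) => //= a l ->.
Qed.

Lemma cmp_has s (f : X -> T -> bool) : cmp s -> cmp (fun p : X * T => f p.1 p.2) ->
  cmp (fun x => has (f x) (s x)).
Proof.
move=> cs cf; apply: (cmp_ext (f := fun x => foldr (fun a r => f x a || r) false (s x))).
  apply: cmp_foldr; cmp_tac.
  by apply: (cmp_comp (g := fun p : X * (T * bool) => (p.1, p.2.1)) cf); cmp_tac.
by move=> x; elim: (s x) => //= a l ->.
Qed.

Lemma cmp_all s (f : X -> T -> bool) : cmp s -> cmp (fun p : X * T => f p.1 p.2) ->
  cmp (fun x => all (f x) (s x)).
Proof.
move=> cs cf; apply: (cmp_ext (f := fun x => foldr (fun a r => f x a && r) true (s x))).
  apply: cmp_foldr; cmp_tac.
  by apply: (cmp_comp (g := fun p : X * (T * bool) => (p.1, p.2.1)) cf); cmp_tac.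
by move=> x; elim: (s x) => //= a l ->.
Qed.

Lemma cmp_find s (f : X -> T -> bool) : cmp s -> cmp (fun p : X * T => f p.1 p.2) ->
  cmp (fun x => find (f x) (s x)).
Proof.
move=> cs cf.
apply: (cmp_ext (f := fun x => foldr (fun a r => if f x a then 0 else r.+1) 0 (s x))).
  apply: cmp_foldr; cmp_tac.
  by apply: (cmp_comp (g := fun p : X * (T * nat) => (p.1, p.2.1)) cf); cmp_tac.
by move=> x; elim: (s x) => //= a l ->.
Qed.

Lemma cmp_mem s (a : X -> T) : cmp a -> cmp s -> cmp (fun x => a x \in s x).
Proof.
move=> ca cs; apply: (cmp_ext (f := fun x => has (fun b => a x == b) (s x))).
  by apply: cmp_has; cmp_tac; apply: cmp_comp ca _; cmp_tac.
by move=> x; rewrite -has_pred1; apply: eq_has => b /=; rewrite eq_sym.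
Qed.

Lemma cmp_nth (d : X -> T) s n : cmp d -> cmp s -> cmp n -> cmp (fun x => nth (d x) (s x) (n x)).
Proof.
move=> cd cs cn; apply: (cmp_ext (f := fun x => head (d x) (iter (n x) behead (s x)))).
  apply: cmp_head => //; apply: cmp_iter => //; apply: cmp_behead; cmp_tac.
by move=> x; elim: (n x) (s x) => [|k IH] [|a l] //; rewrite iterSr IH //= nth_nil.
Qed.

Lemma cmp_last (d : X -> T) s : cmp d -> cmp s -> cmp (fun x => last (d x) (s x)).
Proof.
move=> cd cs; apply: (cmp_ext (f := fun x => foldl (fun _ a => a) (d x) (s x))).
  by apply: cmp_foldl; cmp_tac.
by move=> x; elim: (s x) (d x) => //= a l IH y.
Qed.

Lemma cmp_iota (a b : X -> nat) : cmp a -> cmp b -> cmp (fun x => iota (a x) (b x)).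
Proof.
move=> ca cb; apply: (cmp_ext (f := fun x => rev (iteri (b x) (fun k r => (a x + k) :: r) [::]))).
  apply: cmp_rev; apply: cmp_iteri; cmp_tac; apply: cmp_comp ca _; cmp_tac.
by move=> x; elim: (b x) => // k IH; rewrite [iteri _ _ _]/= rev_cons IH -[in RHS]addn1 iotaD cats1.
Qed.
End Lists2.

Lemma cmp_flatten (X T : countType) (s : X -> seq (seq T)) :
  cmp s -> cmp (fun x => flatten (s x)).
Proof.
by move=> cs; apply: cmp_foldr; cmp_tac; apply: cmp_cat; cmp_tac.
Qed.

Lemma cmp_uniq (X T : countType) (s : X -> seq T) : cmp s -> cmp (fun x => uniq (s x)).
Proof.
(* The fold rebuilds the tail next to the Boolean, since each step tests membership in the tail. *)
move=> cs; apply: (cmp_ext (f := fun x => (foldr (fun a (r : bool * seq T) =>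
  ((a \notin r.2) && r.1, a :: r.2)) (true, [::]) (s x)).1)).
  apply: cmp_fst; apply: cmp_foldr; cmp_tac; apply: cmp_mem; cmp_tac.
move=> x; set f := (X in foldr X _ _).
suff: foldr f (true, [::]) (s x) = (uniq (s x), s x) by move=> ->.
by elim: (s x) => //= a l ->.
Qed.

Ltac cmp_list :=
  match goal with
  | |- cmp (fun x => behead _) => apply: cmp_behead
  | |- cmp (fun x => head _ _) => apply: cmp_head
  | |- cmp (fun x => foldl _ _ _) => apply: cmp_foldl
  | |- cmp (fun x => foldr _ _ _) => apply: cmp_foldr
  | |- cmp (fun x => rev _) => apply: cmp_rev
  | |- cmp (fun x => map _ _) => apply: cmp_map
  | |- cmp (fun x => _ ++ _) => apply: cmp_cat
  | |- cmp (fun x => rcons _ _) => apply: cmp_rcons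
  | |- cmp (fun x => size _) => apply: cmp_size
  | |- cmp (fun x => has _ _) => apply: cmp_has
  | |- cmp (fun x => all _ _) => apply: cmp_all
  | |- cmp (fun x => find _ _) => apply: cmp_find
  | |- cmp (fun x => _ \in _) => apply: cmp_mem
  | |- cmp (fun x => nth _ _ _) => apply: cmp_nth
  | |- cmp (fun x => last _ _) => apply: cmp_last
  | |- cmp (fun x => iota _ _) => apply: cmp_iota
  | |- cmp (fun x => flatten _) => apply: cmp_flatten
  | |- cmp (fun x => uniq _) => apply: cmp_uniq
  end.

Ltac cmp_ext_tac ::= cmp_list.

(** * Decoding of program indices *)

(* Unlike the pickled trees of [enc], these codes are uniquely readable one node
   at a time: [CodeSeq.decode] returns the constructor tag and the children. *)
Fixpoint prog_code (p : prog) : nat :=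
  CodeSeq.code match p with
  | PZero => [:: 0]
  | PSucc => [:: 1]
  | PProj i => [:: 2; i]
  | PComp f gs => [:: 3; prog_code f; progs_code gs]
  | PPrec f g => [:: 4; prog_code f; prog_code g]
  | PMu f => [:: 5; prog_code f]
  | POracle => [:: 6]
  end
with progs_code (ps : progs) : nat :=
  CodeSeq.code match ps with
  | PNil => [:: 7]
  | PCons p ps => [:: 8; prog_code p; progs_code ps]
  end.

Lemma decode_prog_code p : CodeSeq.decode (prog_code p) =
  match p with
  | PZero => [:: 0]
  | PSucc => [:: 1]
  | PProj i => [:: 2; i]
  | PComp f gs => [:: 3; prog_code f; progs_code gs]
  | PPrec f g => [:: 4; prog_code f; prog_code g]
  | PMu f => [:: 5; prog_code f]
  | POracle => [:: 6]
  end.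
Proof. by case: p => *; rewrite -[RHS]CodeSeq.codeK. Qed.

Lemma decode_progs_code ps : CodeSeq.decode (progs_code ps) =
  match ps with
  | PNil => [:: 7]
  | PCons p ps => [:: 8; prog_code p; progs_code ps]
  end.
Proof. by case: ps => *; rewrite -[RHS]CodeSeq.codeK. Qed.

(** The well-formed nodes: a constructor tag with the sorts of its children. *)
Definition prog_sorts : seq (nat * seq nat) :=
  [:: (0, [::]); (1, [::]); (2, [:: 0]); (3, [:: 1; 2]); (4, [:: 1; 1]); (5, [:: 1]); (6, [::])].
Definition progs_sorts : seq (nat * seq nat) := [:: (7, [::]); (8, [:: 1; 2])].

(* A tree is summarised by its sort (0: leaf, 1: program, 2: list of programs,
   3: ill-formed) and the code of the object it denotes. *)
Definition node_val (n : nat) (vs : seq (nat * nat)) : nat * nat :=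
  if (n, map fst vs) \in prog_sorts then (1, CodeSeq.code (n :: map snd vs))
  else if (n, map fst vs) \in progs_sorts then (2, CodeSeq.code (n :: map snd vs))
  else (3, 0).

Fixpoint tree_val (t : GenTree.tree nat) : nat * nat :=
  match t with
  | GenTree.Leaf i => (0, i)
  | GenTree.Node n fs => node_val n (map tree_val fs)
  end.

Lemma node_val_sort n vs : (node_val n vs).1 != 0.
Proof. by rewrite /node_val; case: ifP => // _; case: ifP. Qed.

Definition tree_val_spec t :=
  (if dec t is Some p then tree_val t = (1, prog_code p) else (tree_val t).1 != 1) /\
  (if decs t is Some ps then tree_val t = (2, progs_code ps) else (tree_val t).1 != 2).

Ltac node_simpl :=
  rewrite /= /node_val /= ?inE ?xpair_eqE /= ?eqseq_cons /= ?andbF.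

(** The cases on the tag and the number of children follow the patterns of [dec] and [decs]; a node
    matching none of them gets sort 3. *)
Lemma tree_valP t : tree_val_spec t.
Proof.
elim: t => [i|n fs] //.
have sort3 (v : nat * nat) : v = (3, 0) -> (v.1 != 1) /\ (v.1 != 2) by move=> ->.
case: fs => [|t1 [|t2 [|t3 fs]]] /= IH; rewrite /tree_val_spec.
- by do 9![case: n => [//|n]]; apply: sort3.
- case: IH => -[IH1 IH1s] _.
  do 2![case: n => [|n]; first by apply: sort3; node_simpl].
  case: n => [|n].
    (* Only a leaf has sort 0, so a projection tag over any other child is ill-formed. *)
    case: t1 IH1 IH1s => [i|m fs] _ _ //=.
    have := node_val_sort m (map tree_val fs); move: (node_val m _) => v Hv.
    by node_simpl; rewrite (negPf Hv).
  do 2![case: n => [|n]; first by apply: sort3; node_simpl].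
  case: n => [|n].
    move: IH1 => /=; case: (dec t1) => [p|] H1; first by rewrite /= H1.
    by node_simpl; rewrite (negPf H1).
  by do 3![case: n => [|n]; first by apply: sort3; node_simpl]; apply: sort3; node_simpl.
- case: IH => -[IH1 IH1s] [[IH2 IH2s] _].
  do 2![case: n => [|n]; first by apply: sort3; node_simpl].
  case: n => [|n]; first by case: t1 {IH1 IH1s} => *; apply: sort3; node_simpl.
  case: n => [|n].
    move: IH1 => /=; case: (dec t1) => [p|] H1; last first.
      by node_simpl; rewrite (negPf H1).
    move: IH2s => /=; case: (decs t2) => [ps|] H2; last first.
      by node_simpl; rewrite (negPf H2) andbF.
    by rewrite /= H1 H2.
  case: n => [|n].
    move: IH1 => /=; case: (dec t1) => [p|] H1; last first.
      by node_simpl; rewrite (negPf H1).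
    move: IH2 => /=; case: (dec t2) => [ps|] H2; last first.
      by node_simpl; rewrite (negPf H2) andbF.
    by rewrite /= H1 H2.
  do 3![case: n => [|n]; first by apply: sort3; node_simpl].
  case: n => [|n].
    move: IH1 => /=; case: (dec t1) => [p|] H1; last first.
      by node_simpl; rewrite (negPf H1).
    move: IH2s => /=; case: (decs t2) => [ps|] H2; last first.
      by node_simpl; rewrite (negPf H2) andbF.
    by rewrite /= H1 H2.
  by apply: sort3; node_simpl.
- have E : tree_val (GenTree.Node n [:: t1, t2, t3 & fs]) = (3, 0).
    by node_simpl.
  move: (sort3 _ E); rewrite E; move=> {E IH} H.
  do 2![case: n => [|n] //]; case: n => [|n]; first by case: t1.
  by do 6![case: n => [|n] //].
Qed.

(** One step of the stack machine behind [GenTree.decode], with trees replaced by their summaries.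
    Tokens are read from the right: a leaf is pushed, the token 0 opens a new list of children, and
    the token n + 1 gathers that list into a node with tag n. *)
Definition val_step (m : nat) (st : seq (nat * nat) * seq (seq (nat * nat))) :=
  let d := CodeSeq.decode m in
  if size d == 2 then
    if nth 0 d 1 != 0 then ((0, head 0 (CodeSeq.decode (nth 0 d 1))) :: st.1, st.2)
    else if nth 0 d 0 != 0 then
      let n := head 0 (CodeSeq.decode (nth 0 d 0)) in
      if n == 0 then ([::], st.1 :: st.2)
      else (node_val n.-1 st.1 :: head [::] st.2, behead st.2)
    else st
  else st.

Definition index_code (e : nat) : nat :=
  let v := head (3, 0) (foldr val_step ([::], [::]) (CodeSeq.decode e)).1 in
  if v.1 == 1 then v.2 else prog_code PZero.

(** Unfolds the countable structure of the sum type, which comes from pairs of optional numbers; an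
    optional number is read as the head of a coded list. *)
Lemma unpickle_token (m : nat) : (unpickle m : option (nat + nat)) =
  if CodeSeq.decode m is [:: a; b]
  then sum_of_opair (ohead (CodeSeq.decode a), ohead (CodeSeq.decode b)) else None.
Proof.
have unpickle_opt (a : nat) : (unpickle a : option (option nat)) = Some (ohead (CodeSeq.decode a)).
  have <- : pmap (fun x : nat => Some x) (CodeSeq.decode a) = CodeSeq.decode a.
    by elim: (CodeSeq.decode a) => //= x s ->.
  by [].
have -> : unpickle m = obind sum_of_opair (omap pair_of_tag
  (@unpickle_tagged (option nat) (fun=> option nat) m)) by [].
rewrite /unpickle_tagged; case: (CodeSeq.decode m) => [|a [|b [|? ?]]] //.
by rewrite !unpickle_opt.
Qed.

Lemma decode_eq0 b : (CodeSeq.decode b == [::]) = (b == 0).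
Proof.
rewrite -[b in RHS]CodeSeq.decodeK.
by case: (CodeSeq.decode b) => //= a s; rewrite muln_eq0 expn_eq0.
Qed.

Lemma index_codeE e : index_code e = prog_code (prog_of e).
Proof.
rewrite /index_code /prog_of.
have -> : unpickle e = GenTree.decode (pmap unpickle (CodeSeq.decode e)) by [].
rewrite /GenTree.decode.
set vst := foldr val_step _ _; set st := foldr _ _ _.
(* Throughout the run the numerical stack is the image of the stack of trees under [tree_val]. *)
have -> : vst = (map tree_val st.1, map (map tree_val) st.2).
  rewrite /vst /st; elim: (CodeSeq.decode e) => //= m s ->; rewrite unpickle_token /val_step.
  case: (CodeSeq.decode m) => [|a [|b [|? ?]]] //=.
  rewrite -(decode_eq0 a) -(decode_eq0 b); case: (CodeSeq.decode b) => [|b0 b'] //=.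
  case: (CodeSeq.decode a) => [|[|n] a'] //=; set F := foldr _ _ _.
  by case: F => fs [|f2 fss].
case: st => [[|t fs] fss] //=.
have [] := tree_valP t; case: (dec t) => [p -> //|] /= H _.
by rewrite (negPf H).
Qed.

Lemma cmp_index_code (X : countType) (e : X -> nat) : cmp e -> cmp (fun x => index_code (e x)).
Proof.
apply: cmp_comp; rewrite /index_code /val_step /node_val; cmp_tac. 
Qed.

(** * Checking derivations of the evaluation relation *)

(* A judgement is a list [:: t; x; y; w]: the program (or list of programs) coded
   by t maps the argument list coded by x to the value list coded by y; w codes
   the intermediate values used by the last rule. *)
Definition proved (L : seq (seq nat)) (t : nat) (xs ys : seq nat) : bool :=
  has (fun J => [&& nth 0 J 0 == t, nth 0 J 1 == CodeSeq.code xs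
                  & nth 0 J 2 == CodeSeq.code ys]) L.

(** Both answers to an oracle query are accepted, so the check is independent of the oracle and
    computable; correctness of the answers is a separate condition. The entry w codes the inner
    values of a composition, is the previous value of a recursion, or codes the predecessors of the
    nonzero values met by a minimisation. *)
Definition rule (J : seq nat) (L : seq (seq nat)) : bool :=
  let t := CodeSeq.decode (nth 0 J 0) in
  let xs := CodeSeq.decode (nth 0 J 1) in
  let ys := CodeSeq.decode (nth 0 J 2) in
  let w := nth 0 J 3 in
  let tag := nth 0 t 0 in
  let a := nth 0 t 1 in
  let b := nth 0 t 2 in
  if tag == 0 then ys == [:: 0]
  else if tag == 1 then ys == [:: (head 0 xs).+1]
  else if tag == 2 then ys == [:: nth 0 xs a]
  else if tag == 3 then
    proved L b xs (CodeSeq.decode w) && proved L a (CodeSeq.decode w) ys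
  else if tag == 4 then
    (xs != [::]) &&
    (if head 0 xs == 0 then proved L a (behead xs) ys
     else proved L (nth 0 J 0) ((head 0 xs).-1 :: behead xs) [:: w] &&
          proved L b ((head 0 xs).-1 :: w :: behead xs) ys)
  else if tag == 5 then
    [&& ys == [:: head 0 ys], proved L a (head 0 ys :: xs) [:: 0]
      & all (fun m => proved L a (m :: xs) [:: (nth 0 (CodeSeq.decode w) m).+1])
            (iota 0 (head 0 ys))]
  else if tag == 6 then (ys == [:: 0]) || (ys == [:: 1])
  else if tag == 7 then ys == [::]
  else [&& ys != [::], proved L a xs [:: head 0 ys] & proved L b xs (behead ys)].

Fixpoint derivation (L : seq (seq nat)) : bool :=
  if L is J :: L' then rule J L' && derivation L' else true.

Definition is_query (J : seq nat) : bool := nth 0 (CodeSeq.decode (nth 0 J 0)) 0 == 6.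
Definition query (J : seq nat) : nat := head 0 (CodeSeq.decode (nth 0 J 1)).
Definition answer (J : seq nat) : bool := head 0 (CodeSeq.decode (nth 0 J 2)) == 1.

Definition oracle_correct (A : nat -> Prop) (J : seq nat) : Prop :=
  is_query J -> if answer J then A (query J) else ~ A (query J).

(** Treats both sorts of code at once, and is vacuous for a number that codes neither a program nor
    a list of programs. *)
Definition holds (A : nat -> Prop) (t : nat) (xs ys : seq nat) : Prop :=
  (forall p, t = prog_code p -> exists2 y, ys = [:: y] & evalP A p xs y) /\
  (forall ps, t = progs_code ps -> evalL A ps xs ys).

(** Each case of [rule] mirrors constructors of the semantics, and its premises lie in the tail, to
    which the induction hypothesis applies. *)
Lemma derivation_sound A L : derivation L ->
  (forall J, J \in L -> oracle_correct A J) ->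
  forall t xs ys, proved L t xs ys -> holds A t xs ys.
Proof.
elim: L => //= J L IH /andP[HJ /IH {}IH] Ho.
have {}IH t xs ys : proved L t xs ys -> holds A t xs ys.
  by apply: IH => K HK; apply: Ho; rewrite inE HK orbT.
move=> t xs ys /orP[/and3P[/eqP <- /eqP Ex /eqP Ey]|]; last exact: IH.
have {}Ho := Ho J (mem_head _ _).
move: HJ Ho; rewrite /rule /oracle_correct /is_query /query /answer Ex Ey !CodeSeq.codeK.
move: (nth 0 J 0) (nth 0 J 3) => {Ex Ey J} {}t w HJ Ho.
split.
  move=> p Et; move: HJ Ho; rewrite Et.
  case: p {Et t} => [||i|f gs|f g|f|]; rewrite decode_prog_code /=.
  - by move=> /eqP -> _; exists 0 => //; apply: eZero.
  - by move=> /eqP -> _; exists (head 0 xs).+1 => //; apply: eSucc.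
  - by move=> /eqP -> _; exists (nth 0 xs i) => //; apply: eProj.
  - move=> /andP[/IH [_ /(_ _ (erefl _)) Hg] /IH [/(_ _ (erefl _)) [y -> Hf] _]] _.
    by exists y => //; apply: eComp Hg Hf.
  - case: xs => [//|n xs] /=; case: eqP => [->|/eqP n0].
      by move=> /IH [/(_ _ (erefl _)) [y -> Hf] _] _; exists y => //; apply: ePrec0.
    move=> /andP[/IH [/(_ (PPrec f g) (erefl _)) [y [<-] Hf] _]
                 /IH [/(_ _ (erefl _)) [z -> Hg] _]] _.
    by exists z => //; rewrite -(prednK (n := n)) ?lt0n //; apply: ePrecS Hf Hg.
  - move=> /and3P[/eqP -> /IH [/(_ _ (erefl _)) [y [<-] Hf] _] /allP Hm] _.
    exists (head 0 ys) => //; apply: eMu => // m lt.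
    have /Hm /IH [/(_ _ (erefl _)) [z [<-] Hz] _] : m \in iota 0 (head 0 ys).
      by rewrite mem_iota.
    by eexists; apply: Hz.
  - move=> /orP[] /eqP -> /(_ isT) /= H.
      by exists 0 => //; apply: eOracleF.
    by exists 1 => //; apply: eOracleT.
move=> ps Et; move: HJ {Ho}; rewrite Et.
case: ps {Et t} => [|p ps]; rewrite decode_progs_code /=.
  by move=> /eqP ->; apply: eNil.
case: ys => [//|y ys] /= /andP[/IH [/(_ _ (erefl _)) [z [<-] Hz] _] /IH [_ /(_ _ (erefl _)) Hg]].
exact: eCons.
Qed.

(** The list occurs in [rule] only through positive occurrences of [proved]. This is what permits
    concatenating the derivations of several premises. *)
Lemma rule_sub J L L' : (forall t xs ys, proved L t xs ys -> proved L' t xs ys) ->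
  rule J L -> rule J L'.
Proof.
move=> H; rewrite /rule; do 3![case: ifP => _ //].
case: ifP => _; first by move=> /andP[/H -> /H ->].
case: ifP => _.
  by case/andP=> -> /=; case: ifP => _ => [/H //|/andP[/H -> /H ->]].
case: ifP => _.
  case/and3P=> -> /H -> /= /allP Hall; apply/allP => m /Hall; exact: H.
do 2![case: ifP => _ //].
by case/and3P=> -> /H -> /H ->.
Qed.

Lemma proved_cat L1 L2 t xs ys :
  proved (L1 ++ L2) t xs ys = proved L1 t xs ys || proved L2 t xs ys.
Proof. exact: has_cat. Qed.

Lemma derivation_cat L1 L2 : derivation L1 -> derivation L2 -> derivation (L1 ++ L2).
Proof.
move=> H1 H2; elim: L1 H1 => //= J L1 IH /andP[HJ /IH ->]; rewrite andbT.
by apply: rule_sub HJ => t xs ys H; rewrite proved_cat H.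
Qed.

Definition correct_derivation (A : nat -> Prop) (L : seq (seq nat)) : Prop :=
  derivation L /\ forall J, J \in L -> oracle_correct A J.

Definition derivable A t xs ys : Prop := exists2 L, correct_derivation A L & proved L t xs ys.

Lemma correct_derivation_cat A L1 L2 :
  correct_derivation A L1 -> correct_derivation A L2 -> correct_derivation A (L1 ++ L2).
Proof.
move=> [H1 O1] [H2 O2]; split; first exact: derivation_cat.
by move=> J; rewrite mem_cat => /orP[/O1|/O2].
Qed.

Lemma derivable_rule A L t xs ys w : correct_derivation A L ->
  let J := [:: t; CodeSeq.code xs; CodeSeq.code ys; w] in
  rule J L -> oracle_correct A J -> derivable A t xs ys.
Proof.
move=> [HL OL] J HJ OJ; exists (J :: L); last by rewrite /proved /= !eqxx.
split=> /=; first by rewrite HJ.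
by move=> K; rewrite inE => /orP[/eqP ->|/OL].
Qed.

Lemma not_query A t xs ys w : nth 0 (CodeSeq.decode t) 0 != 6 ->
  oracle_correct A [:: t; xs; ys; w].
Proof. by move=> H; rewrite /oracle_correct /is_query /= (negPf H). Qed.

Lemma correct_derivation_nil A : correct_derivation A [::].
Proof. by []. Qed.

Ltac rule_simpl := rewrite /rule; cbn [nth];
  rewrite ?CodeSeq.codeK ?decode_prog_code ?decode_progs_code /=.

Lemma derivation_complete A :
  (forall p xs y, evalP A p xs y -> derivable A (prog_code p) xs [:: y]) /\
  (forall ps xs ys, evalL A ps xs ys -> derivable A (progs_code ps) xs ys).
Proof.
have nil := correct_derivation_nil A.
apply: evalP_mutual_ind.
- move=> xs; apply: (derivable_rule (w := 0) nil); last exact: not_query.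
  by rule_simpl; rewrite ?eqxx.
- move=> xs; apply: (derivable_rule (w := 0) nil); last exact: not_query.
  by rule_simpl; rewrite ?eqxx.
- move=> i xs; apply: (derivable_rule (w := 0) nil).
    by rule_simpl; rewrite ?eqxx.
  by apply: not_query; rewrite decode_prog_code.
- move=> f gs xs ys y [L1 H1 P1] [L2 H2 P2].
  apply: (derivable_rule (w := CodeSeq.code ys) (correct_derivation_cat H1 H2)).
    rule_simpl.
    by rewrite !proved_cat P1 P2 orbT.
  by apply: not_query; rewrite decode_prog_code.
- move=> f g xs y [L1 H1 P1].
  apply: (derivable_rule (w := 0) H1).
    by rule_simpl.
  by apply: not_query; rewrite decode_prog_code.
- move=> f g n xs z y [L1 H1 P1] [L2 H2 P2].
  apply: (derivable_rule (w := z) (correct_derivation_cat H1 H2)).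
    rule_simpl.
    by rewrite !proved_cat P2 P1 orbT.
  by apply: not_query; rewrite decode_prog_code.
- move=> f xs n [L1 H1 P1] Hlt.
  (* Every m < n comes with its own derivation and value; induction on n merges them into one
     derivation and one list of values. *)
  have [L2 H2 [ks P2]] : exists2 L2, correct_derivation A L2 & exists ks : seq nat,
      forall m, m < n -> proved L2 (prog_code f) (m :: xs) [:: (nth 0 ks m).+1].
    elim: n Hlt {P1} => [|n IH] Hlt; first by exists [::] => //; exists [::].
    have [m lt|L2 H2 [ks P2]] := IH; first by apply: Hlt; apply: ltnW.
    have [k [L3 H3 P3]] := Hlt n (ltnSn n).
    exists (L2 ++ L3); first exact: correct_derivation_cat.
    exists (mkseq (fun m => if m == n then k else nth 0 ks m) n.+1) => m lt.
    rewrite nth_mkseq // proved_cat; case: eqP => [->|/eqP ne]; first by rewrite P3 orbT.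
    by rewrite P2 // ltn_neqAle ne.
  apply: (derivable_rule (w := CodeSeq.code ks) (correct_derivation_cat H1 H2)).
    rule_simpl.
    rewrite eqxx proved_cat P1 /=; apply/allP => m; rewrite mem_iota => lt.
    by rewrite proved_cat P2 ?orbT.
  by apply: not_query; rewrite decode_prog_code.
- move=> xs H; apply: (derivable_rule (w := 0) nil).
    by rule_simpl.
  by rewrite /oracle_correct /answer /query; cbn [nth]; rewrite !CodeSeq.codeK.
- move=> xs H; apply: (derivable_rule (w := 0) nil).
    by rule_simpl.
  by rewrite /oracle_correct /answer /query; cbn [nth]; rewrite !CodeSeq.codeK.
- move=> xs; apply: (derivable_rule (w := 0) nil).
    by rule_simpl.
  by apply: not_query; rewrite decode_progs_code.
- move=> p ps xs y ys [L1 H1 P1] [L2 H2 P2].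
  apply: (derivable_rule (w := 0) (correct_derivation_cat H1 H2)).
    rule_simpl.
    by rewrite !proved_cat P1 P2 orbT.
  by apply: not_query; rewrite decode_progs_code.
Qed.

Lemma evalP_derivable A p xs y :
  evalP A p xs y <-> derivable A (prog_code p) xs [:: y].
Proof.
split; first exact: (derivation_complete A).1.
move=> [L [H1 H2] H3]; have [/(_ p (erefl _)) [z [->]] //] := derivation_sound H1 H2 H3.
Qed.

Lemma cmp_proved (X : countType) L t xs ys : cmp L -> cmp t -> cmp xs -> cmp ys ->
  cmp (fun x : X => proved (L x) (t x) (xs x) (ys x)).
Proof.
move=> cL ct cx cy; rewrite /proved; apply: cmp_has => //; cmp_tac.
- by apply: cmp_comp ct _; cmp_tac.
- by apply: cmp_comp cx _; cmp_tac.
- by apply: cmp_comp cy _; cmp_tac.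
Qed.

Lemma cmp_rule (X : countType) J L : cmp J -> cmp L -> cmp (fun x : X => rule (J x) (L x)).
Proof.
move=> cJ cL.
apply: (cmp_comp (f := fun p => rule p.1 p.2) (g := fun x => (J x, L x))); last by cmp_tac.
by rewrite /rule; cmp_tac; apply: cmp_proved; cmp_tac.
Qed.

Lemma cmp_derivation (X : countType) L : cmp L -> cmp (fun x : X => derivation (L x)).
Proof.
move=> cL; apply: (cmp_ext (f := fun x => (foldr (fun J (r : bool * seq (seq nat)) =>
  (rule J r.2 && r.1, J :: r.2)) (true, [::]) (L x)).1)).
  by cmp_tac; apply: cmp_rule; cmp_tac.
move=> x; set f := (X in foldr X _ _).
suff -> : foldr f (true, [::]) (L x) = (derivation (L x), L x) by [].
by elim: (L x) => //= a l ->.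
Qed.

(* [CodeSeq.decode] is onto, so number quantifiers range over all lists of lists. *)
Definition lists_of (d : nat) : seq (seq nat) :=
  [seq CodeSeq.decode c | c <- CodeSeq.decode d].

Lemma lists_of_surj L : exists d, lists_of d = L.
Proof.
exists (CodeSeq.code (map CodeSeq.code L)); rewrite /lists_of CodeSeq.codeK.
exact: mapK CodeSeq.codeK _.
Qed.

(* The oracle is empty, so no query may be answered affirmatively. *)
Definition run (e x y d : nat) : bool :=
  [&& derivation (lists_of d), all (fun J => is_query J ==> ~~ answer J) (lists_of d)
    & proved (lists_of d) (index_code e) [:: x] [:: y]].

(** A normal form: convergence is a search for one number d satisfying a relation that is decidable
    uniformly in the index. *)
Lemma phiE e x y : phi e x y <-> exists d, run e x y d.
Proof.
rewrite /phi /phiA evalP_derivable -index_codeE; split.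
  move=> [L [H1 H2] H3]; have [d Ed] := lists_of_surj L.
  exists d; rewrite /run Ed H1 H3 andbT /=; apply/allP => J HJ.
  by apply/implyP => /(H2 J HJ); case: answer.
move=> [d /and3P[H1 /allP H2 H3]]; exists (lists_of d) => //; split=> // J HJ Hq.
by have := implyP (H2 J HJ) Hq; case: answer => // _ [].
Qed.

Lemma run_phi e x y d : run e x y d -> phi e x y.
Proof. by move=> H; apply/phiE; exists d. Qed.

Lemma cmp_run (X : countType) e x y d : cmp e -> cmp x -> cmp y -> cmp d ->
  cmp (fun z : X => run (e z) (x z) (y z) (d z)).
Proof.
move=> ce cx cy cd.
apply: (cmp_comp (f := fun p : nat * nat * (nat * nat) => run p.1.1 p.1.2 p.2.1 p.2.2)
  (g := fun z => ((e z, x z), (y z, d z)))); last by cmp_tac.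
rewrite /run /lists_of; cmp_tac.
- by apply: cmp_derivation; cmp_tac.
- by rewrite /is_query /answer /implb; cmp_tac.
- by apply: cmp_proved; cmp_tac; apply: cmp_index_code; cmp_tac.
Qed.

(** * Arithmetical classes *)

Definition Sig2 (X : countType) (Q : X -> Prop) : Prop :=
  exists2 f : X * (nat * nat) -> bool, cmp f &
    forall x, Q x <-> exists b, forall c, f (x, (b, c)).

Definition Pi3 (X : countType) (Q : X -> Prop) : Prop :=
  exists2 S : X * nat -> Prop, Sig2 S & forall x, Q x <-> forall a, S (x, a).

Section Sig2Closure.
Variable X : countType.
Implicit Types Q : X -> Prop.

Lemma Sig2_ext Q Q' : Sig2 Q -> (forall x, Q x <-> Q' x) -> Sig2 Q'.
Proof. by move=> [f cf Hf] E; exists f => // x; rewrite -E. Qed.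

Lemma Sig2_comp (Y : countType) Q (g : Y -> X) : Sig2 Q -> cmp g -> Sig2 (fun y => Q (g y)).
Proof.
move=> [f cf Hf] cg; exists (fun p => f (g p.1, p.2)) => [|y]; last by rewrite Hf.
by apply: (cmp_comp cf); cmp_tac; apply: (cmp_comp cg); cmp_tac.
Qed.

Lemma Sig2_dec (p : X -> bool) : cmp p -> Sig2 (fun x => p x).
Proof.
move=> cp; exists (fun q => p q.1); first by apply: (cmp_comp cp); cmp_tac.
by move=> x; split=> [|[b /(_ 0)]] //; exists 0.
Qed.

Lemma Sig2_forall (p : X * nat -> bool) : cmp p -> Sig2 (fun x => forall c, p (x, c)).
Proof.
move=> cp; exists (fun q => p (q.1, q.2.2)); first by apply: (cmp_comp cp); cmp_tac.
by move=> x; split=> [H|[b H]] //; exists 0.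
Qed.

Lemma Sig2_exists (Q : X * nat -> Prop) : Sig2 Q -> Sig2 (fun x => exists n, Q (x, n)).
Proof.
move=> [f cf Hf]; exists (fun q => f ((q.1, nth 0 (CodeSeq.decode q.2.1) 0),
  (nth 0 (CodeSeq.decode q.2.1) 1, q.2.2))).
  by apply: (cmp_comp cf); cmp_tac.
move=> x; split=> [[n /Hf [b H]]|[b H]].
  by exists (CodeSeq.code [:: n; b]) => c; rewrite CodeSeq.codeK.
exists (nth 0 (CodeSeq.decode b) 0); apply/Hf.
by exists (nth 0 (CodeSeq.decode b) 1) => c; apply: H.
Qed.

Lemma Sig2_and Q1 Q2 : Sig2 Q1 -> Sig2 Q2 -> Sig2 (fun x => Q1 x /\ Q2 x).
Proof.
move=> [f cf Hf] [g cg Hg].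
exists (fun q => f (q.1, (nth 0 (CodeSeq.decode q.2.1) 0, q.2.2)) &&
                 g (q.1, (nth 0 (CodeSeq.decode q.2.1) 1, q.2.2))).
  by cmp_tac; [apply: (cmp_comp cf) | apply: (cmp_comp cg)]; cmp_tac.
move=> x; rewrite Hf Hg; split=> [[[b Hb] [b' Hb']]|[b H]].
  by exists (CodeSeq.code [:: b; b']) => c; rewrite CodeSeq.codeK Hb Hb'.
by split; [exists (nth 0 (CodeSeq.decode b) 0) | exists (nth 0 (CodeSeq.decode b) 1)] => c;
  have /andP[] := H c.
Qed.

Lemma Sig2_or Q1 Q2 : Sig2 Q1 -> Sig2 Q2 -> Sig2 (fun x => Q1 x \/ Q2 x).
Proof.
move=> [f cf Hf] [g cg Hg].
(* The first entry of the coded witness selects the disjunct, the second is a witness for it. *)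
exists (fun q => if nth 0 (CodeSeq.decode q.2.1) 0 == 0
                 then f (q.1, (nth 0 (CodeSeq.decode q.2.1) 1, q.2.2))
                 else g (q.1, (nth 0 (CodeSeq.decode q.2.1) 1, q.2.2))).
  by cmp_tac; [apply: (cmp_comp cf) | apply: (cmp_comp cg)]; cmp_tac.
move=> x; rewrite Hf Hg; split=> [[[b Hb]|[b Hb]]|[b]].
- by exists (CodeSeq.code [:: 0; b]) => c; rewrite CodeSeq.codeK Hb.
- by exists (CodeSeq.code [:: 1; b]) => c; rewrite CodeSeq.codeK Hb.
- by rewrite /=; case: (nth 0 (CodeSeq.decode b) 0 == 0) => H; [left | right];
    exists (nth 0 (CodeSeq.decode b) 1) => c; apply: H.
Qed.

(* The witnesses for the members of the list are collected in one list. *)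
Lemma Sig2_all (T : countType) (d : T) (Q : X * T -> Prop) (l : X -> seq T) :
  Sig2 Q -> cmp l -> Sig2 (fun x => forall t, t \in l x -> Q (x, t)).
Proof.
move=> [f cf Hf] cl.
exists (fun q => all (fun i => f ((q.1, nth d (l q.1) i), (nth 0 (CodeSeq.decode q.2.1) i, q.2.2)))
                     (iota 0 (size (l q.1)))).
  cmp_tac; first by apply: (cmp_comp cl); cmp_tac.
  by apply: (cmp_comp cf); cmp_tac; apply: (cmp_comp cl); cmp_tac.
move=> x /=; split=> [H|[b H] t /(nthP d) [i lt <-]]; last first.
  apply/Hf; exists (nth 0 (CodeSeq.decode b) i) => c.
  by have /allP /(_ i) := H c; rewrite mem_iota; apply.
have [bs Hbs] : exists bs : seq nat, forall i, i < size (l x) ->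
    forall c, f ((x, nth d (l x) i), (nth 0 bs i, c)).
  elim: (l x) H => [|t s IH] H; first by exists [::].
  have [t' Ht'|bs Hbs] := IH; first by apply: H; rewrite inE Ht' orbT.
  have /Hf [b Hb] := H t (mem_head _ _).
  by exists (b :: bs) => -[|i] //= lt; apply: Hbs.
exists (CodeSeq.code bs) => c; apply/allP => i; rewrite mem_iota CodeSeq.codeK => lt.
exact: Hbs.
Qed.

End Sig2Closure.

Section Pi3Closure.
Variable X : countType.
Implicit Types Q : X -> Prop.

Lemma Pi3_ext Q Q' : Pi3 Q -> (forall x, Q x <-> Q' x) -> Pi3 Q'.
Proof. by move=> [f cf Hf] E; exists f => // x; rewrite -E. Qed.

Lemma Pi3_Sig2 Q : Sig2 Q -> Pi3 Q.
Proof.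
move=> HQ; exists (fun p => Q p.1); first by apply: (Sig2_comp HQ); cmp_tac.
by move=> x; split=> // /(_ 0).
Qed.

Lemma Pi3_and Q1 Q2 : Pi3 Q1 -> Pi3 Q2 -> Pi3 (fun x => Q1 x /\ Q2 x).
Proof.
move=> [S1 H1 E1] [S2 H2 E2]; exists (fun p => S1 p /\ S2 p); first exact: Sig2_and.
move=> x; rewrite E1 E2; split=> [[? ?] a //|H].
by split=> a; have [] := H a.
Qed.

Lemma Pi3_forall (Q : X * nat -> Prop) : Pi3 Q -> Pi3 (fun x => forall n, Q (x, n)).
Proof.
move=> [S HS E].
exists (fun p => S ((p.1, nth 0 (CodeSeq.decode p.2) 0), nth 0 (CodeSeq.decode p.2) 1)).
  by apply: (Sig2_comp HS); cmp_tac.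
move=> x; split=> [H a|H n]; first exact: (E (x, _)).1.
apply/E => a; have := H (CodeSeq.code [:: n; a]).
by cbn [fst snd]; rewrite CodeSeq.codeK.
Qed.

(** The implication says that every candidate witness a for [Q1] is refuted by some c unless [Q2]
    holds; for fixed a this is a disjunction of Sigma^0_2 conditions. *)
Lemma Pi3_imp Q1 Q2 : Sig2 Q1 -> Sig2 Q2 -> Pi3 (fun x => Q1 x -> Q2 x).
Proof.
move=> [f cf Hf] H2.
exists (fun p : X * nat => (exists c, ~~ f (p.1, (p.2, c))) \/ Q2 p.1).
  apply: Sig2_or; last by apply: (Sig2_comp H2); cmp_tac.
  apply: (Sig2_exists (Q := fun q : X * nat * nat => ~~ f (q.1.1, (q.1.2, q.2)))).
  by apply: Sig2_dec; cmp_tac; apply: (cmp_comp cf); cmp_tac.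
move=> x; split=> [H a|H /Hf [b Hb]].
  have [/H|nQ] := EM (Q1 x); first by right.
  left; apply: contrapT => /= Hn; apply: nQ; apply/Hf; exists a => c.
  by apply: contrapT => /negP Hc; apply: Hn; exists c.
by have [[c]|//] := H b; rewrite Hb.
Qed.

Lemma Sig2_imp_dec (p : X -> bool) Q : cmp p -> Sig2 Q -> Sig2 (fun x => p x -> Q x).
Proof.
move=> cp HQ; apply: (Sig2_ext (Q := fun x => ~~ p x \/ Q x)).
  by apply: Sig2_or => //; apply: Sig2_dec; cmp_tac.
move=> x; split; first by case=> // /negP.
by case: (p x) => H; [right; apply: H | left].
Qed.
End Pi3Closure.

Lemma cmp_phi (X Y : countType) (f : X -> Y) :
  cmp f <-> exists e, forall x, phi e (pickle x) (pickle (f x)).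
Proof.
split=> [[p Hp]|[e He]]; last by exists (prog_of e).
by have [e Ee] := prog_of_surj p; exists e => x; rewrite /phi /phiA Ee.
Qed.

Lemma computable_predP (P : seq nat -> Prop) :
  computable_pred P <-> exists2 f : seq nat -> bool, cmp f & forall s, P s <-> f s.
Proof.
split=> [[e He]|[f /cmp_phi [e He] Hf]].
  exists (fun s => `[< P s >]); last by move=> s; rewrite asboolE.
  apply/cmp_phi; exists e => s; have [H1 H2] := He s.
  by case: asboolP => H; [apply: H1 | apply: H2].
exists e => s; have := He s; rewrite Hf; case: (f s) => H; split=> // -[].
Qed.

Lemma Pi03_relP R : Pi03_rel R <-> Pi3 (fun p : nat * nat => R p.1 p.2).
Proof.
split=> [[P [/computable_predP [f cf Hf] HR]]|[S [f cf Hf] HS]].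
  exists (fun p => exists b, forall c, P [:: p.1.1; p.1.2; p.2; b; c]); last by case.
  exists (fun q => f [:: q.1.1.1; q.1.1.2; q.1.2; q.2.1; q.2.2]).
    by apply: (cmp_comp cf); cmp_tac.
  by move=> x; split=> -[b H]; exists b => c; [apply: (Hf _).1 (H c) | apply: (Hf _).2 (H c)].
exists (fun s => f (((nth 0 s 0, nth 0 s 1), nth 0 s 2), (nth 0 s 3, nth 0 s 4))); split.
  apply/computable_predP; exists (fun s => f (((nth 0 s 0, nth 0 s 1), nth 0 s 2),
    (nth 0 s 3, nth 0 s 4))) => //.
  by apply: (cmp_comp cf); cmp_tac.
move=> x y; rewrite (HS (x, y)); split=> H a; first exact: (Hf _).1 (H a).
by apply: (Hf ((x, y), a)).2; have [b Hb] := H a; exists b.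
Qed.

Lemma Sig2_phi (X : countType) (e x y : X -> nat) : cmp e -> cmp x -> cmp y ->
  Sig2 (fun z => phi (e z) (x z) (y z)).
Proof.
move=> ce cx cy.
apply: (Sig2_ext (Q := fun z => exists d, run (e z) (x z) (y z) d)); last first.
  by move=> z; rewrite phiE.
apply: (Sig2_exists (Q := fun p => run (e p.1) (x p.1) (y p.1) p.2)).
apply: Sig2_dec; apply: cmp_run; cmp_tac.
- by apply: (cmp_comp ce); cmp_tac.
- by apply: (cmp_comp cx); cmp_tac.
- by apply: (cmp_comp cy); cmp_tac.
Qed.

Lemma Sig2_jump0 : Sig2 jump0.
Proof.
apply: (Sig2_exists (Q := fun p : nat * nat => phi p.1 p.1 p.2)).
by apply: Sig2_phi; cmp_tac.
Qed.

Lemma Sig2_not_jump0 : Sig2 (fun u => ~ jump0 u).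
Proof.
apply: (Sig2_ext (Q := fun u => forall c,
  ~~ run u u (nth 0 (CodeSeq.decode c) 0) (nth 0 (CodeSeq.decode c) 1))).
  apply: (Sig2_forall (p := fun p : nat * nat => ~~ run p.1 p.1
    (nth 0 (CodeSeq.decode p.2) 0) (nth 0 (CodeSeq.decode p.2) 1))).
  by apply: cmp_not; apply: cmp_run; cmp_tac.
move=> u; split=> [H [y /phiE [d Hd]]|H c].
  by have := H (CodeSeq.code [:: y; d]); rewrite CodeSeq.codeK Hd.
by apply/negP => Hc; apply: H; eexists; apply/phiE; eexists; apply: Hc.
Qed.

(** Membership means that some derivation of some output has only correct oracle answers. A single
    answer is a Sigma^0_2 condition because both the jump and its complement are Sigma^0_2, and
    there are finitely many answers. *)
Lemma Sig2_W' : Sig2 (fun p : nat * nat => W' p.1 p.2).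
Proof.
pose Q (p : nat * nat * nat * nat) := (derivation (lists_of p.2) &&
    proved (lists_of p.2) (index_code p.1.1.1) [:: p.1.1.2] [:: p.1.2]) /\
  forall J, J \in lists_of p.2 -> oracle_correct jump0 J.
have HQ : Sig2 (fun p => exists y, exists d, Q (p, y, d)).
  apply: (Sig2_exists (Q := fun p => exists d, Q (p, d))).
  apply: Sig2_exists; apply: Sig2_and.
    apply: Sig2_dec; rewrite /lists_of; cmp_tac; first by apply: cmp_derivation; cmp_tac.
    by apply: cmp_proved; cmp_tac; apply: cmp_index_code; cmp_tac.
  apply: (Sig2_all [::] (Q := fun p : _ * seq nat => oracle_correct jump0 p.2)); last first.
    by rewrite /lists_of; cmp_tac.
  apply: (Sig2_comp (g := snd) (Q := oracle_correct jump0)); last by cmp_tac.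
  apply: Sig2_imp_dec; first by rewrite /is_query; cmp_tac.
  apply: (Sig2_ext (Q := fun J => (answer J /\ jump0 (query J)) \/
    (~~ answer J /\ ~ jump0 (query J)))).
    by apply: Sig2_or; apply: Sig2_and; try (by apply: Sig2_dec; rewrite /answer; cmp_tac);
      [apply: (Sig2_comp Sig2_jump0) | apply: (Sig2_comp Sig2_not_jump0)]; rewrite /query; cmp_tac.
  by move=> J; case: answer; split; [case=> -[] | left | case=> -[] | right].
apply: (Sig2_ext HQ) => -[e x]; split.
  move=> [y [d [/andP[/= H1 H2] H3]]]; exists y; apply/evalP_derivable.
  by exists (lists_of d) => //; rewrite -index_codeE.
move=> [y /evalP_derivable [L [H1 H2] H3]]; have [d Ed] := lists_of_surj L.
by exists y, d; rewrite /Q /= Ed index_codeE H1 H3.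
Qed.

(** * Isomorphism of equivalence structures with finite classes *)

Definition finite_classes (R : nat -> nat -> Prop) : Prop :=
  forall x, exists s : seq nat, forall y, R x y -> y \in s.

(** The head is the representative. For reflexive [R] the empty list is excluded, since its default
    head 0 is related to itself. *)
Definition enumerates_class (R : nat -> nat -> Prop) (l : seq nat) : Prop :=
  forall y, y \in l <-> R (head 0 l) y.

(** There are at least k classes of size n: uniqueness of the flattened list says both that no list
    has repetitions and that the lists are disjoint. *)
Definition has_classes (R : nat -> nat -> Prop) (n k : nat) : Prop :=
  exists ll : seq (seq nat), [/\ size ll = k, all (fun l => size l == n) ll,
    uniq (flatten ll) & forall l, l \in ll -> enumerates_class R l].

Lemma count_iotaS (p : pred nat) m : count p (iota 0 m.+1) = count p (iota 0 m) + p m.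
Proof. by rewrite -addn1 iotaD count_cat /= addn0. Qed.

Lemma count_iota_lt (p : pred nat) m n : p m -> m < n ->
  count p (iota 0 m) < count p (iota 0 n).
Proof.
move=> pm lt; apply: (@leq_trans (count p (iota 0 m.+1))).
  by rewrite count_iotaS pm addn1.
by rewrite -(subnKC lt) iotaD count_cat leq_addr.
Qed.

Lemma count_iota_inj (p : pred nat) m n : p m -> p n ->
  count p (iota 0 m) = count p (iota 0 n) -> m = n.
Proof.
move=> pm pn E; case: (ltngtP m n) => // lt.
  by have := count_iota_lt pm lt; rewrite E ltnn.
by have := count_iota_lt pn lt; rewrite E ltnn.
Qed.

(** The count grows by at most one at each step, so no value below it is skipped. *)
Lemma count_iota_attained (p : pred nat) k m : k < count p (iota 0 m) ->
  exists2 z, p z & count p (iota 0 z) = k.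
Proof.
elim: m => // m IH; rewrite count_iotaS; case pm: (p m); last by rewrite addn0.
rewrite addn1 ltnS leq_eqVlt => /orP[/eqP ->|/IH //].
by exists m.
Qed.

(** * A complete invariant for elements of a structure with finite classes *)

Section Invariant.
Variables (r : rel nat) (bnd : nat -> nat).
Hypothesis r_refl : reflexive r.
Hypothesis r_sym : symmetric r.
Hypothesis r_trans : transitive r.
Hypothesis r_bnd : forall x y, r x y -> y < bnd x.

(** The bound lets a class be listed in increasing order, so that its head is its least element. *)
Definition class_of x := [seq y <- iota 0 (bnd x) | r x y].
Definition class_min x := head 0 (class_of x).
Definition min_of_size n z := (class_min z == z) && (size (class_of z) == n).
(** The number of classes of the same size with a smaller least element. *)
Definition class_rank x := count (min_of_size (size (class_of x))) (iota 0 (class_min x)).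
Definition invariant x := (size (class_of x), class_rank x, index x (class_of x)).

Lemma mem_class_of x y : (y \in class_of x) = r x y.
Proof.
rewrite mem_filter mem_iota; apply: andb_idr => /r_bnd.
by rewrite add0n.
Qed.

Lemma uniq_class_of x : uniq (class_of x).
Proof. by rewrite filter_uniq // iota_uniq. Qed.

Lemma class_of_eq x y : r x y -> class_of x = class_of y.
Proof.
move=> rxy; apply: (irr_sorted_eq ltn_trans ltnn).
- exact: sorted_filter ltn_trans _ _ (iota_ltn_sorted _ _).
- exact: sorted_filter ltn_trans _ _ (iota_ltn_sorted _ _).
move=> z; rewrite !mem_class_of; apply/idP/idP; last exact: r_trans.
by apply: r_trans; rewrite r_sym.
Qed.

Lemma class_of_gt0 x : 0 < size (class_of x).
Proof. by rewrite -has_predT; apply/hasP; exists x; rewrite // mem_class_of. Qed.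

Lemma class_min_rel x : r x (class_min x).
Proof.
rewrite -mem_class_of /class_min; move: (class_of_gt0 x).
by case: (class_of x) => //= a l _; rewrite mem_head.
Qed.

Lemma class_min_of_size x : min_of_size (size (class_of x)) (class_min x).
Proof.
have E := class_of_eq (class_min_rel x).
by rewrite /min_of_size {1}/class_min -E !eqxx.
Qed.

Lemma class_rankP x y :
  r x y <-> (size (class_of x), class_rank x) = (size (class_of y), class_rank y).
Proof.
split=> [rxy|[En Ek]]; first by rewrite /class_rank /class_min (class_of_eq rxy).
have E : class_min x = class_min y.
  apply: (@count_iota_inj (min_of_size (size (class_of x)))).
  - exact: class_min_of_size.
  - by rewrite En class_min_of_size.
  - by move: Ek; rewrite /class_rank -En.
apply: r_trans (class_min_rel x) _; rewrite E r_sym; exact: class_min_rel.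
Qed.

Lemma invariant_inj : injective invariant.
Proof.
move=> x y [En Ek Ei].
have rxy : r x y by apply/class_rankP; rewrite En Ek.
rewrite -(nth_index 0 (s := class_of x) (x := x)) ?mem_class_of //.
by rewrite Ei (class_of_eq rxy) nth_index // mem_class_of.
Qed.

(** More than k classes of size n yield a least element z of rank k; the element sought is the m-th
    member of the class of z. *)
Lemma invariant_attained n k m : m < n ->
  (exists M, k < count (min_of_size n) (iota 0 M)) -> exists x, invariant x = (n, k, m).
Proof.
move=> lt [M /count_iota_attained [z /andP[/eqP Ez /eqP Es] Ek]].
have /(mem_nth 0) Hm : m < size (class_of z) by rewrite Es.
set x := nth 0 (class_of z) m in Hm; exists x.
have rzx : r z x by rewrite -mem_class_of.
rewrite /invariant /class_rank /class_min -(class_of_eq rzx) Es -/(class_min z) Ez Ek.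
by rewrite index_uniq ?uniq_class_of // Es.
Qed.

Lemma has_classes_count n k : 0 < n ->
  has_classes r n k <-> exists M, k <= count (min_of_size n) (iota 0 M).
Proof.
move=> n0; split=> [[ll [Ek /allP Hn Hu Hc]]|[M HM]].
  have Hcls l : l \in ll -> class_of (head 0 l) =i l.
    by move=> /Hc H y; rewrite mem_class_of; apply/idP/idP => /H.
  have Hul l : l \in ll -> uniq l.
    elim: ll Hu {Ek Hn Hc Hcls} => //= a ll IH; rewrite cat_uniq => /and3P[ua _ /IH {}IH].
    by rewrite inE => /orP[/eqP ->|].
  (* Disjoint classes have distinct least elements, and all of these are counted below their maximum
     plus one. *)
  pose ms := [seq class_min (head 0 l) | l <- ll].
  have Hms : forall z, z \in ms -> min_of_size n z.
    move=> z /mapP [l Hl ->]; have <- : size (class_of (head 0 l)) = n.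
      rewrite -(eqP (Hn l Hl)); apply: perm_size; apply: uniq_perm.
      - exact: uniq_class_of.
      - exact: Hul.
      - exact: Hcls.
    exact: class_min_of_size.
  have Hmin l : l \in ll -> class_min (head 0 l) \in l.
    by move=> Hl; rewrite -(Hcls _ Hl) mem_class_of class_min_rel.
  have Ums : uniq ms.
    rewrite /ms; elim: ll Hu Hmin {Ek Hn Hc Hcls Hul ms Hms} => //= a ll IH.
    rewrite cat_uniq => /and3P[ua Hd /IH {}IH] Hmin; apply/andP; split; last first.
      by apply: IH => l Hl; apply: Hmin; rewrite inE Hl orbT.
    apply/mapP => -[l Hl E]; move/hasPn: Hd => /(_ (class_min (head 0 l))).
    rewrite -E Hmin ?mem_head // => /(_ _)/negP; apply => //.
    apply/flattenP; exists l => //; rewrite E; apply: Hmin; rewrite inE Hl orbT //.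
  exists (\max_(z <- ms) z).+1; rewrite -Ek -(size_map (fun l => class_min (head 0 l))).
  rewrite -size_filter; apply: uniq_leq_size => // z Hz.
  rewrite mem_filter Hms // mem_iota add0n ltnS.
  exact: (@leq_bigmax_seq _ ms xpredT id).
(* Conversely, the classes of the first k such least elements are disjoint. *)
pose zs := take k [seq z <- iota 0 M | min_of_size n z].
have Hzs z : z \in zs -> min_of_size n z.
  by move=> /mem_take; rewrite mem_filter => /andP[].
have Uzs : uniq zs by rewrite take_uniq // filter_uniq // iota_uniq.
exists (map class_of zs); split.
- by rewrite size_map size_take size_filter; case: ltngtP HM.
- by apply/allP => l /mapP [z /Hzs /andP[_ ?] ->].
- elim: zs Hzs Uzs => //= z zs IH Hzs /andP[nz uz]; rewrite cat_uniq uniq_class_of /=.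
  rewrite IH ?andbT //; last by move=> y Hy; apply: Hzs; rewrite inE Hy orbT.
  apply/hasPn => y /flattenP [l /mapP [w Hw ->]]; rewrite mem_class_of => rwy.
  rewrite /= mem_class_of; apply: contra nz => rzy.
  have Hz := Hzs z (mem_head _ _).
  have Hw' : min_of_size n w by apply: Hzs; rewrite inE Hw orbT.
  move: Hz Hw' => /andP[/eqP <- _] /andP[/eqP Ew _].
  rewrite /class_min (@class_of_eq z w) -/(class_min w) ?Ew //.
  by apply: r_trans rzy _; rewrite r_sym.
- move=> l /mapP [z /Hzs /andP[/eqP Ez _] ->] y.
  by rewrite -/(class_min z) Ez mem_class_of.
Qed.

Lemma class_rank_has_classes x : has_classes r (size (class_of x)) (class_rank x).+1.
Proof.
apply/has_classes_count; first exact: class_of_gt0.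
by exists (class_min x).+1; rewrite count_iotaS class_min_of_size addn1.
Qed.
End Invariant.

(** The decision and the bounds come from classical logic and choice: an isomorphism is not asked to
    be computable. *)
Lemma bounded_boolean_rel (R : nat -> nat -> Prop) : is_equiv_rel R -> finite_classes R ->
  exists (r : rel nat) (bnd : nat -> nat), [/\ reflexive r, symmetric r, transitive r,
    forall x y, r x y -> y < bnd x & forall x y, R x y <-> r x y].
Proof.
move=> [Rr [Rs Rt]] Rf; exists (fun x y => `[< R x y >]).
have /choice [bnd Hbnd] : forall x, exists b, forall y, `[< R x y >] -> y < b.
  move=> x; have [s Hs] := Rf x; exists (\max_(z <- s) z).+1 => y /asboolP /Hs Hy.
  by rewrite ltnS; apply: (@leq_bigmax_seq _ s xpredT id).
exists bnd; split=> //.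
- by move=> x; apply/asboolP.
- by move=> x y; apply/asboolP/asboolP; apply: Rs.
- by move=> y x z /asboolP H1 /asboolP H2; apply/asboolP; apply: Rt H1 H2.
- by move=> x y; rewrite asboolE.
Qed.

Lemma has_classes_ext R S n k : (forall x y, R x y <-> S x y) ->
  has_classes R n k -> has_classes S n k.
Proof.
move=> E [ll [H1 H2 H3 H4]]; exists ll; split=> // l /H4 H y.
by rewrite H E.
Qed.

(* An element is determined by the size of its class, the rank of the class among
   those of the same size, and its index in the class; the triples that occur are
   determined by the numbers of classes of each size. *)
Lemma has_classes_isomorphic R S :
  is_equiv_rel R -> finite_classes R -> is_equiv_rel S -> finite_classes S ->
  (forall n k, 0 < n -> has_classes R n k <-> has_classes S n k) -> isomorphic R S.
Proof.
move=> eR fR eS fS H.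
have [r [br [rr rs rt rb Er]]] := bounded_boolean_rel eR fR.
have [s [bs [sr ss st sb Es]]] := bounded_boolean_rel eS fS.
have transfer (r1 r2 : rel nat) b1 b2 : reflexive r1 -> symmetric r1 -> transitive r1 ->
    (forall x y, r1 x y -> y < b1 x) -> reflexive r2 -> symmetric r2 -> transitive r2 ->
    (forall x y, r2 x y -> y < b2 x) ->
    (forall n k, 0 < n -> has_classes r1 n k -> has_classes r2 n k) ->
    forall x, exists y, invariant r2 b2 y = invariant r1 b1 x.
  move=> h1 h2 h3 h4 h5 h6 h7 h8 Hn x; apply: invariant_attained => //.
    by rewrite index_mem mem_class_of.
  have n0 := class_of_gt0 h1 h4 x.
  apply/has_classes_count => //; apply: Hn => //; exact: class_rank_has_classes.
have Hrs n k : 0 < n -> has_classes r n k <-> has_classes s n k.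
  have Hr : has_classes r n k <-> has_classes R n k.
    by split; apply: has_classes_ext => x y; rewrite Er.
  have Hs : has_classes s n k <-> has_classes S n k.
    by split; apply: has_classes_ext => x y; rewrite Es.
  by rewrite Hr Hs; apply: H.
have /choice [f Hf] := transfer r s br bs rr rs rt rb sr ss st sb (fun n k n0 => (Hrs n k n0).1).
have /choice [g Hg] := transfer s r bs br sr ss st sb rr rs rt rb (fun n k n0 => (Hrs n k n0).2).
exists f; split.
  exists g => x.
    by apply: (invariant_inj rr rs rt rb); rewrite Hg Hf.
  by apply: (invariant_inj sr ss st sb); rewrite Hf Hg.
move=> x y; rewrite Er Es.
rewrite (class_rankP rr rs rt rb) (class_rankP sr ss st sb).
by have [-> -> _] := Hf x; have [-> -> _] := Hf y.
Qed.

Lemma isomorphic_sym R S : isomorphic R S -> isomorphic S R.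
Proof.
move=> [f [[g fK gK] H]]; exists g; split; first by exists f.
by move=> x y; rewrite H !gK.
Qed.

Lemma isomorphic_has_classes R S n k : 0 < n -> isomorphic R S ->
  has_classes R n k -> has_classes S n k.
Proof.
move=> n0 [f [[g fK gK] H]] [ll [H1 /allP H2 H3 H4]].
exists (map (map f) ll); split.
- by rewrite size_map.
- by apply/allP => _ /mapP [l Hl ->]; rewrite size_map; apply: H2.
- by rewrite -map_flatten map_inj_uniq //; apply: can_inj fK.
move=> _ /mapP [l Hl ->] y.
(* As n is positive, l is nonempty and its head is not the default value. *)
have -> : head 0 (map f l) = f (head 0 l).
  by have := H2 l Hl; case: l Hl => //= _; rewrite eq_sym => /eqP E; move: n0; rewrite E.
by rewrite -[y]gK -H -(H4 _ Hl) mem_map //; apply: can_inj fK.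
Qed.

(** * The isomorphism problem is Pi^0_3 *)

Lemma cmp_cpair (X : countType) a b : cmp a -> cmp b -> cmp (fun x : X => cpair (a x) (b x)).
Proof. by move=> ca cb; rewrite /cpair; cmp_tac. Qed.

Ltac cmp_ext_tac ::= first [cmp_list |
  match goal with |- cmp (fun x => cpair _ _) => apply: cmp_cpair end].

Lemma phi_functional e x y z : phi e x y -> phi e x z -> y = z.
Proof. by move=> H1 H2; apply: evalP_functional H1 _ H2. Qed.

Lemma Pi3_E0_field : Pi3 E0_field.
Proof.
have Htotal : Pi3 (fun e => forall x y, phi e (cpair x y) 0 \/ phi e (cpair x y) 1).
  apply: (Pi3_forall (Q := fun p : nat * nat =>
    forall y, phi p.1 (cpair p.2 y) 0 \/ phi p.1 (cpair p.2 y) 1)).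
  apply: (Pi3_forall (Q := fun p : nat * nat * nat =>
    phi p.1.1 (cpair p.1.2 p.2) 0 \/ phi p.1.1 (cpair p.1.2 p.2) 1)).
  by apply: Pi3_Sig2; apply: Sig2_or; apply: Sig2_phi; cmp_tac.
have Hrefl : Pi3 (fun e => forall x, eqstr e x x).
  apply: (Pi3_forall (Q := fun p : nat * nat => phi p.1 (cpair p.2 p.2) 1)).
  by apply: Pi3_Sig2; apply: Sig2_phi; cmp_tac.
have Hsym : Pi3 (fun e => forall x y, eqstr e x y -> eqstr e y x).
  apply: (Pi3_forall (Q := fun p : nat * nat =>
    forall y, phi p.1 (cpair p.2 y) 1 -> phi p.1 (cpair y p.2) 1)).
  apply: (Pi3_forall (Q := fun p : nat * nat * nat =>
    phi p.1.1 (cpair p.1.2 p.2) 1 -> phi p.1.1 (cpair p.2 p.1.2) 1)).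
  by apply: Pi3_imp; apply: Sig2_phi; cmp_tac.
have Htrans : Pi3 (fun e => forall x y z, eqstr e x y -> eqstr e y z -> eqstr e x z).
  apply: (Pi3_forall (Q := fun p : nat * nat => forall y z,
    eqstr p.1 p.2 y -> eqstr p.1 y z -> eqstr p.1 p.2 z)).
  apply: (Pi3_forall (Q := fun p : nat * nat * nat => forall z,
    eqstr p.1.1 p.1.2 p.2 -> eqstr p.1.1 p.2 z -> eqstr p.1.1 p.1.2 z)).
  apply: (Pi3_forall (Q := fun p : nat * nat * nat * nat =>
    eqstr p.1.1.1 p.1.1.2 p.1.2 -> eqstr p.1.1.1 p.1.2 p.2 -> eqstr p.1.1.1 p.1.1.2 p.2)).
  apply: (Pi3_ext (Q := fun p : nat * nat * nat * nat =>
    phi p.1.1.1 (cpair p.1.1.2 p.1.2) 1 /\ phi p.1.1.1 (cpair p.1.2 p.2) 1 ->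
    phi p.1.1.1 (cpair p.1.1.2 p.2) 1)).
    by apply: Pi3_imp; first apply: Sig2_and; apply: Sig2_phi; cmp_tac.
  by move=> p; rewrite /eqstr; tauto.
have Hfin : Pi3 (fun e => finite_classes (eqstr e)).
  apply: (Pi3_forall (Q := fun p : nat * nat => exists s : seq nat,
    forall y, eqstr p.1 p.2 y -> y \in s)).
  apply: Pi3_Sig2.
  (* Finiteness of one class is Sigma^0_2: s codes a list containing every y for which some run
     accepts the pair; c codes y together with the run. *)
  apply: (Sig2_ext (Q := fun p : nat * nat => exists s, forall c,
    run p.1 (cpair p.2 (nth 0 (CodeSeq.decode c) 0)) 1 (nth 0 (CodeSeq.decode c) 1) ==>
    (nth 0 (CodeSeq.decode c) 0 \in CodeSeq.decode s))).
    apply: (Sig2_exists (Q := fun q : nat * nat * nat => forall c,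
      run q.1.1 (cpair q.1.2 (nth 0 (CodeSeq.decode c) 0)) 1 (nth 0 (CodeSeq.decode c) 1) ==>
      (nth 0 (CodeSeq.decode c) 0 \in CodeSeq.decode q.2))).
    apply: (Sig2_forall (p := fun q : nat * nat * nat * nat =>
      run q.1.1.1 (cpair q.1.1.2 (nth 0 (CodeSeq.decode q.2) 0)) 1
        (nth 0 (CodeSeq.decode q.2) 1) ==>
      (nth 0 (CodeSeq.decode q.2) 0 \in CodeSeq.decode q.1.2))).
    by rewrite /implb; cmp_tac; apply: cmp_run; cmp_tac.
  move=> [e x]; split=> [[s H]|[s H]].
    exists (CodeSeq.decode s) => y /phiE [d Hd].
    by have := H (CodeSeq.code [:: y; d]); rewrite CodeSeq.codeK Hd.
  exists (CodeSeq.code s) => c; rewrite CodeSeq.codeK; apply/implyP => Hr.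
  by apply: H; apply: run_phi Hr.
apply: Pi3_and => //; apply: Pi3_and => //.
by apply: Pi3_and => //; apply: Pi3_and.
Qed.

(** Read as a number, [y \notin l] is the wrong answer to whether y is in the class listed by l; no
    run may produce it. On the field, totality leaves the right answer as the only alternative, so a
    single universal quantifier suffices. *)
Definition lists_classes (e c y d : nat) : bool :=
  all (fun l => ~~ run e (cpair (head 0 l) y) (y \notin l) d) (lists_of c).

Lemma has_classes_eqstr e n k : E0_field e -> has_classes (eqstr e) n k <->
  exists c, [&& size (lists_of c) == k, all (fun l => size l == n) (lists_of c)
               & uniq (flatten (lists_of c))] /\
    forall v, lists_classes e c (nth 0 (CodeSeq.decode v) 0) (nth 0 (CodeSeq.decode v) 1).
Proof.
move=> [Ht _]; split=> [[ll [H1 H2 H3 H4]]|[c [/and3P[/eqP H1 H2 H3] H4]]].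
  have [c Ec] := lists_of_surj ll; exists c; rewrite Ec H1 H2 H3 eqxx; split=> // v.
  rewrite /lists_classes Ec; apply/allP => l /H4 Hl; apply/negP => Hr.
  have Hv := run_phi Hr; case: (boolP (_ \in l)) Hv => Hy /=.
    by have /Hl He := Hy => /(phi_functional He).
  by move=> /Hl; rewrite (negPf Hy).
exists (lists_of c); split=> // l Hl y; split=> [Hy|/phiE [d Hd]].
  have [/phiE [d Hd]|//] := Ht (head 0 l) y.
  have /allP /(_ l Hl) := H4 (CodeSeq.code [:: y; d]).
  by rewrite CodeSeq.codeK /= Hy Hd.
have /allP /(_ l Hl) := H4 (CodeSeq.code [:: y; d]).
by rewrite CodeSeq.codeK /=; case: (y \in l) => //=; rewrite Hd.
Qed.

Lemma Pi3_E0_iso :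
  Pi3 (fun p : nat * nat => E0_field p.1 /\ E0_field p.2 /\ E0_iso p.1 p.2).
Proof.
pose Q (p : nat * (nat * nat)) := exists c,
  [&& size (lists_of c) == p.2.2, all (fun l => size l == p.2.1) (lists_of c)
    & uniq (flatten (lists_of c))] /\
  forall v, lists_classes p.1 c (nth 0 (CodeSeq.decode v) 0) (nth 0 (CodeSeq.decode v) 1).
have HQ : Sig2 Q.
  apply: (Sig2_exists (Q := fun q : nat * (nat * nat) * nat =>
    [&& size (lists_of q.2) == q.1.2.2, all (fun l => size l == q.1.2.1) (lists_of q.2)
      & uniq (flatten (lists_of q.2))] /\
    forall v, lists_classes q.1.1 q.2 (nth 0 (CodeSeq.decode v) 0) (nth 0 (CodeSeq.decode v) 1))).
  apply: Sig2_and; first by apply: Sig2_dec; rewrite /lists_of; cmp_tac.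
  apply: (Sig2_forall (p := fun q : nat * (nat * nat) * nat * nat =>
    lists_classes q.1.1.1 q.1.2 (nth 0 (CodeSeq.decode q.2) 0) (nth 0 (CodeSeq.decode q.2) 1))).
  by rewrite /lists_classes /lists_of; cmp_tac; apply: cmp_run; cmp_tac.
(* Only positive sizes are compared, hence n + 1; each equivalence is split into two implications
   between Sigma^0_2 conditions. *)
have Hiso : Pi3 (fun p : nat * nat => forall n k,
    (Q (p.1, (n.+1, k)) -> Q (p.2, (n.+1, k))) /\ (Q (p.2, (n.+1, k)) -> Q (p.1, (n.+1, k)))).
  apply: (Pi3_forall (Q := fun p : nat * nat * nat => forall k,
    (Q (p.1.1, (p.2.+1, k)) -> Q (p.1.2, (p.2.+1, k))) /\
    (Q (p.1.2, (p.2.+1, k)) -> Q (p.1.1, (p.2.+1, k))))).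
  apply: (Pi3_forall (Q := fun p : nat * nat * nat * nat =>
    (Q (p.1.1.1, (p.1.2.+1, p.2)) -> Q (p.1.1.2, (p.1.2.+1, p.2))) /\
    (Q (p.1.1.2, (p.1.2.+1, p.2)) -> Q (p.1.1.1, (p.1.2.+1, p.2))))).
  by apply: Pi3_and; apply: Pi3_imp; apply: (Sig2_comp HQ); cmp_tac.
have Hfield : Pi3 (fun p : nat * nat => E0_field p.1 /\ E0_field p.2).
  by have [S HS ES] := Pi3_E0_field; apply: Pi3_and;
    [exists (fun q => S (q.1.1, q.2)) | exists (fun q => S (q.1.2, q.2))];
    try (by apply: (Sig2_comp HS); cmp_tac); move=> x; rewrite ES.
apply: (Pi3_ext (Pi3_and Hfield Hiso)) => -[i j] /=; split=> [[[fi fj] H]|[fi [fj H]]].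
  split=> //; split=> //; have [_ [ei ci]] := fi; have [_ [ej cj]] := fj.
  apply: has_classes_isomorphic => // -[//|n] k _.
  by rewrite (has_classes_eqstr _ _ fi) (has_classes_eqstr _ _ fj); have [] := H n k.
split=> // n k.
have := isomorphic_has_classes (ltn0Sn n) H (k := k).
have := isomorphic_has_classes (ltn0Sn n) (isomorphic_sym H) (k := k).
by rewrite (has_classes_eqstr _ _ fi) (has_classes_eqstr _ _ fj).
Qed.

(** * The s-m-n theorem *)

Lemma cmp_encode (X : countType) (t : X -> GenTree.tree nat) :
  cmp t -> cmp (fun x => GenTree.encode (t x)).
Proof. by move=> ct; apply: cmp_code ct _. Qed.

(** A tree has the code of its token list, and a node lists the tokens of its children between n + 1
    and 0. *)
Lemma cmp_node2 (X : countType) n (s t : X -> GenTree.tree nat) :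
  cmp s -> cmp t -> cmp (fun x => GenTree.Node n [:: s x; t x]).
Proof.
move=> cs ct; apply: (cmp_code (f := fun x => (inl n.+1 : nat + nat) ::
  rcons (GenTree.encode (s x) ++ GenTree.encode (t x)) (inl 0))).
  by cmp_tac; apply: cmp_encode.
by move=> x; rewrite -[GenTree.encode (t x)]cats0.
Qed.

Fixpoint const_prog (n : nat) : prog :=
  if n is m.+1 then PComp PSucc (PCons (const_prog m) PNil) else PZero.

Lemma evalP_const A n xs : evalP A (const_prog n) xs n.
Proof.
elim: n => [|n IH] /=; first exact: eZero.
apply: (@eComp _ _ _ _ [:: n]); last exact: (eSucc _ [:: n]).
by apply: eCons IH _; apply: eNil.
Qed.

Lemma cmp_const_prog (X : countType) (n : X -> nat) :
  cmp n -> cmp (fun x => enc (const_prog (n x))).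
Proof.
move=> cn; apply: (cmp_ext (f := fun x => iter (n x)
  (fun t => GenTree.Node 3 [:: enc PSucc; GenTree.Node 8 [:: t; encs PNil]]) (enc PZero))).
  apply: cmp_iter => //; first exact: cmp_const.
  by apply: cmp_node2; [apply: cmp_const | apply: cmp_node2; cmp_tac].
by move=> x; elim: (n x) => //= k ->.
Qed.

(** The program with index g e pairs a hard-wired constant e with its input and then runs the
    program of [f]; its syntax tree depends computably on e. *)
Lemma smn (f : nat * nat -> nat) : cmp f ->
  exists2 g : nat -> nat, cmp g & forall e z, phi (g e) z (f (e, z)).
Proof.
move=> [p Hp]; have [pp Hpp] := cn_pair (cn_proj 2 0) (cn_proj 2 1).
pose q e := PComp p (PCons (PComp pp (PCons (const_prog e) (PCons (PProj 0) PNil))) PNil).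
have cq : cmp (fun e => enc (q e)).
  apply: (cmp_ext (f := fun e => GenTree.Node 3 [:: enc p; GenTree.Node 8
    [:: GenTree.Node 3 [:: enc pp; GenTree.Node 8
          [:: enc (const_prog e); encs (PCons (PProj 0) PNil)]];
        encs PNil]])) => //.
  apply: cmp_node2; first exact: cmp_const.
  apply: cmp_node2; last exact: cmp_const.
  apply: cmp_node2; first exact: cmp_const.
  apply: cmp_node2; last exact: cmp_const.
  exact: cmp_const_prog (cmp_id _).
exists (fun e => pickle (enc (q e))); first exact: cmp_pickle cq.
move=> e z; rewrite /phi /phiA.
have -> : prog_of (pickle (enc (q e))) = q e.
  by rewrite /prog_of pickleK (proj1 dec_enc_all).
apply: (@eComp _ _ _ _ [:: pickle (e, z)]); last exact: Hp.
apply: eCons; last exact: eNil.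
apply: (@eComp _ _ _ _ [:: e; z]); last exact: (Hpp [:: e; z]).
apply: eCons; first exact: evalP_const.
by apply: eCons; [apply: (eProj _ 0 [:: z]) | apply: eNil].
Qed.

(** * The Cantor pairing function and its inverses *)

Lemma triangularS s : (s.+1 * s.+2)./2 = (s * s.+1)./2 + s.+1.
Proof.
have -> : s.+1 * s.+2 = s * s.+1 + s.+1.*2 by lia.
by rewrite halfD odd_double andbF add0n doubleK.
Qed.

Lemma triangular_mono s t : s <= t -> (s * s.+1)./2 <= (t * t.+1)./2.
Proof. by move=> le; apply: half_leq; apply: leq_mul. Qed.

(** The values on the diagonal x + y = s lie from the s-th triangular number to just below the next
    one, so the value determines s and then y. *)
Lemma cpair_inj x y x' y' : cpair x y = cpair x' y' -> x = x' /\ y = y'.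
Proof.
rewrite /cpair => E.
case: (ltngtP (x + y) (x' + y')) => [lt|lt|Es].
- by have := triangular_mono lt; rewrite triangularS; lia.
- by have := triangular_mono lt; rewrite triangularS; lia.
- by move: E; rewrite Es; lia.
Qed.

Lemma cpair_ge x y : x <= cpair x y /\ y <= cpair x y.
Proof.
have H s : s <= (s * s.+1)./2 by elim: s => // s IH; rewrite triangularS; lia.
by rewrite /cpair; have := H (x + y); lia.
Qed.

Definition cfst (z : nat) : nat :=
  find (fun x => has (fun y => cpair x y == z) (iota 0 z.+1)) (iota 0 z.+1).
Definition csnd (z : nat) : nat := find (fun y => cpair (cfst z) y == z) (iota 0 z.+1).

Lemma find_iota (p : pred nat) n k : k < n -> p k -> (forall i, p i -> i = k) ->
  find p (iota 0 n) = k.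
Proof.
move=> lt pk H; have Hp : has p (iota 0 n) by apply/hasP; exists k; rewrite // mem_iota.
have := nth_find 0 Hp; rewrite nth_iota ?add0n; first exact: H.
by move: Hp; rewrite has_find size_iota.
Qed.

Lemma cfstK x y : cfst (cpair x y) = x.
Proof.
have [Hx Hy] := cpair_ge x y; apply: find_iota; first by rewrite ltnS.
  by apply/hasP; exists y => //; rewrite mem_iota ltnS.
by move=> i /hasP [j _ /eqP /cpair_inj []].
Qed.

Lemma csndK x y : csnd (cpair x y) = y.
Proof.
have [Hx Hy] := cpair_ge x y; apply: find_iota; rewrite ?cfstK ?ltnS //.
by move=> i /eqP /cpair_inj [].
Qed.

(** * Coding a Sigma^0_2 set into an equivalence structure *)

Section Coding.
Variable f : nat * nat * (nat * nat) -> bool.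

(* Shifting the witness makes the witness 0 fail, so that there are always
   infinitely many classes of each odd size. *)
Definition survives (e x a b : nat) : bool := (a != 0) && f ((e, x), (a.-1, b)).

(* The class with key [:: x, a & _] has 2x+2 elements, plus one more if the
   candidate witness a is refuted for x: its position is the first refutation. *)
Definition member (e : nat) (key : seq nat) (t : nat) : bool :=
  let x := nth 0 key 0 in
  let a := nth 0 key 1 in
  let n := (x + x).+2 in
  (t < n) || (~~ survives e x a (t - n) && all (fun b => survives e x a b) (iota 0 (t - n))).

(** A number codes t :: key, the position t in the class of [key]. Numbers failing this test, among
    them the code of the empty list, are singleton classes. *)
Definition in_class (e u : nat) : bool :=
  (CodeSeq.decode u != [::]) && member e (behead (CodeSeq.decode u)) (head 0 (CodeSeq.decode u)).

Definition coded_eq (e u v : nat) : bool :=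
  (u == v) || [&& behead (CodeSeq.decode u) == behead (CodeSeq.decode v),
                  in_class e u & in_class e v].

Lemma coded_eq_refl e u : coded_eq e u u.
Proof. by rewrite /coded_eq eqxx. Qed.

Lemma coded_eq_equiv e : is_equiv_rel (coded_eq e).
Proof.
split; first exact: coded_eq_refl.
split=> [u v|u v w]; rewrite /coded_eq.
  by move=> /orP[/eqP -> | /and3P[/eqP -> -> ->]]; rewrite !eqxx ?orbT.
move=> /orP[/eqP -> //|/and3P[/eqP E1 H1 H2]] /orP[/eqP <-|/and3P[/eqP E2 _ H3]].
  by rewrite E1 H1 H2 eqxx orbT.
by rewrite E1 E2 H1 H3 eqxx orbT.
Qed.

Lemma member_survives e key : (forall b, survives e (nth 0 key 0) (nth 0 key 1) b) ->
  forall t, member e key t = (t \in iota 0 (nth 0 key 0 + nth 0 key 0).+2).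
Proof. by move=> H t; rewrite /member mem_iota H /= orbF. Qed.

Lemma member_refuted e key b : ~~ survives e (nth 0 key 0) (nth 0 key 1) b ->
  exists b0, forall t, member e key t =
    (t \in rcons (iota 0 (nth 0 key 0 + nth 0 key 0).+2) ((nth 0 key 0 + nth 0 key 0).+2 + b0)).
Proof.
move=> Hb; have /ex_minnP [b0 H0 Hmin] : exists b, ~~ survives e (nth 0 key 0) (nth 0 key 1) b.
  by exists b.
exists b0 => t; rewrite /member mem_rcons inE mem_iota add0n leq0n andTb orbC.
case: ltnP => [_|le]; rewrite ?orbT // !orbF.
apply/andP/eqP => [[H1 /allP H2]|->]; last first.
  rewrite addKn; split=> //; apply/allP => c; rewrite mem_iota add0n => /= lt.
  by apply: contraTT lt => /Hmin; rewrite -leqNgt.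
have le1 := Hmin _ H1.
suff: t - (nth 0 key 0 + nth 0 key 0).+2 <= b0 by lia.
rewrite leqNgt; apply/negP => lt; have := H2 b0; rewrite mem_iota add0n lt (negPf H0).
by move=> /(_ isT).
Qed.

Definition elem (key : seq nat) (t : nat) : nat := CodeSeq.code (t :: key).

Lemma decode_elem key t : CodeSeq.decode (elem key t) = t :: key.
Proof. exact: CodeSeq.codeK. Qed.

Lemma elem_inj key : injective (elem key).
Proof. by move=> s t /(can_inj CodeSeq.codeK) []. Qed.

Lemma elem_surj u : CodeSeq.decode u != [::] ->
  u = elem (behead (CodeSeq.decode u)) (head 0 (CodeSeq.decode u)).
Proof.
by rewrite -{2}[u]CodeSeq.decodeK /elem; case: (CodeSeq.decode u).
Qed.

Lemma in_class_elem e key t : in_class e (elem key t) = member e key t.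
Proof. by rewrite /in_class decode_elem. Qed.

Lemma coded_eq_elem e key t l : (forall t, member e key t = (t \in l)) -> t \in l ->
  forall v, coded_eq e (elem key t) v = (v \in map (elem key) l).
Proof.
move=> Hl Ht v; rewrite /coded_eq decode_elem in_class_elem Hl Ht /=.
apply/idP/mapP => [/orP[/eqP <-|/andP[/eqP Ek /andP[Hv Hm]]]|[s Hs ->]].
- by exists t.
- move: Hm; rewrite -Ek Hl => Hm; exists (head 0 (CodeSeq.decode v)) => //.
  by rewrite Ek -elem_surj.
- by rewrite decode_elem in_class_elem Hl Hs eqxx orbT.
Qed.

Lemma enumerates_elem e key l : (forall t, member e key t = (t \in l)) -> 0 < size l ->
  enumerates_class (coded_eq e) (map (elem key) l).
Proof.
move=> Hl; case: l Hl => // t l Hl _ v /=.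
by rewrite (coded_eq_elem Hl (mem_head _ _)).
Qed.

Lemma coded_eq_singleton e u v : ~~ in_class e u -> coded_eq e u v = (v == u).
Proof. by move=> H; rewrite /coded_eq (negPf H) /= andbF orbF eq_sym. Qed.

Lemma member_list e key : exists2 l, forall t, member e key t = (t \in l) &
  uniq l /\
  ((forall b, survives e (nth 0 key 0) (nth 0 key 1) b) /\ size l = (nth 0 key 0 + nth 0 key 0).+2
   \/ size l = (nth 0 key 0 + nth 0 key 0).+3).
Proof.
have [H|/existsNP [b /negP /member_refuted [b0 Hb]]] :=
  EM (forall b, survives e (nth 0 key 0) (nth 0 key 1) b).
  exists (iota 0 (nth 0 key 0 + nth 0 key 0).+2); first exact: member_survives.
  by rewrite iota_uniq size_iota; split=> //; left.
eexists; first exact: Hb.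
rewrite size_rcons size_iota rcons_uniq iota_uniq mem_iota; split; last by right.
by rewrite add0n -leqNgt leq_addr.
Qed.

Lemma coded_eq_finite e : finite_classes (coded_eq e).
Proof.
move=> u; case: (boolP (in_class e u)) => [/andP[Hu Hm]|Hu]; last first.
  by exists [:: u] => v; rewrite coded_eq_singleton // inE.
have [l Hl _] := member_list e (behead (CodeSeq.decode u)).
exists (map (elem (behead (CodeSeq.decode u))) l) => v.
by rewrite {1}(elem_surj Hu) (coded_eq_elem Hl) // -Hl.
Qed.

Lemma has_classes_family (R : nat -> nat -> Prop) (F : nat -> seq nat) n k :
  (forall j, size (F j) = n) -> (forall j, uniq (F j)) ->
  (forall j, enumerates_class R (F j)) ->
  (forall i j y, y \in F i -> y \in F j -> i = j) -> has_classes R n k.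
Proof.
move=> Hs Hu He Hd; exists [seq F j | j <- iota 0 k]; split.
- by rewrite size_map size_iota.
- by apply/allP => l /mapP [j _ ->]; rewrite Hs.
- elim: (iota 0 k) (iota_uniq 0 k) => //= j s IH /andP[nj /IH {}IH].
  rewrite cat_uniq Hu IH andbT /=; apply/hasPn => y /flattenP [l /mapP [i Hi ->] Hy].
  by apply/negP => /= Hj; move: nj; rewrite (Hd _ _ _ Hj Hy) Hi.
- by move=> l /mapP [j _ ->].
Qed.

(** Every size occurs infinitely often or not at all, so a positive k does not matter. The copies
    come from the third entry of the key, which [member] ignores. *)
Lemma has_classes_coded e n k : 0 < n -> has_classes (coded_eq e) n k <->
  [\/ k = 0, n = 1, exists x, n = (x + x).+3
    | exists2 x, n = (x + x).+2 & exists a, forall b, f ((e, x), (a, b))].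
Proof.
move=> n0; split.
  case: k => [|k] [ll [Hk Hn Hu Hc]]; first by constructor 1.
  case: ll Hk Hn Hu Hc => // l ll _ /= /andP[/eqP En _].
  rewrite cat_uniq => /andP[ul _] /(_ l (mem_head _ _)) Hl.
  case: (boolP (in_class e (head 0 l))) => [/andP[Hu Hm]|Hu]; last first.
    constructor 2; apply/eqP; rewrite eqn_leq n0 andbT -En.
    apply: (@uniq_leq_size _ l [:: head 0 l]) => // v /Hl.
    by rewrite coded_eq_singleton // inE.
  have [s Hs [us Hsize]] := member_list e (behead (CodeSeq.decode (head 0 l))).
  have E : n = size s.
    rewrite -En -(size_map (elem (behead (CodeSeq.decode (head 0 l)))) s).
    apply/perm_size/uniq_perm => //; first by rewrite map_inj_uniq //; apply: elem_inj.
    move=> v; rewrite -(coded_eq_elem Hs (t := head 0 (CodeSeq.decode (head 0 l)))) -?Hs //.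
    by rewrite -elem_surj //; apply/idP/idP => /Hl.
  case: Hsize => [[Hsurv Es]|Es]; last by constructor 3; eexists; rewrite E Es.
  constructor 4; eexists; first by rewrite E Es.
  (* The predecessor undoes the shift of witnesses in [survives]. *)
  exists (nth 0 (behead (CodeSeq.decode (head 0 l))) 1).-1 => b.
  by have /andP[] := Hsurv b.
have family (F : nat -> seq nat) l : injective F ->
    (forall j t, member e (F j) t = (t \in l)) -> uniq l -> 0 < size l ->
    has_classes (coded_eq e) (size l) k.
  move=> HF Hm ul Es; apply: (@has_classes_family _ (fun j => map (elem (F j)) l)).
  - by move=> j; rewrite size_map.
  - by move=> j; rewrite map_inj_uniq //; apply: elem_inj.
  - by move=> j; apply: enumerates_elem.
  - by move=> i j y /mapP [s _ ->] /mapP [t _ /(can_inj CodeSeq.codeK) [_ /HF]].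
case=> [->|->|[x ->]|[x -> [a Ha]]].
- by exists [::].
(* For the empty key, x and the witness default to 0, so the class has positions 0, 1 and b0 + 2;
   all positions from b0 + 3 on give singletons. *)
- have [|b0 Hb] := @member_refuted e [::] 0; first by [].
  apply: (@has_classes_family _ (fun j => [:: elem [::] (b0 + j).+3])) => //.
    move=> j v; rewrite /= coded_eq_singleton ?inE // in_class_elem Hb.
    by rewrite mem_rcons inE mem_iota /=; lia.
  by move=> i j y; rewrite !inE => /eqP -> /eqP /elem_inj; lia.
(* The witness 0 is always refuted, which yields classes of size 2x + 3. *)
- have [|b0 Hb] := @member_refuted e [:: x; 0; 0] 0; first by [].
  have := family (fun j => [:: x; 0; j]) _ _ (fun j => Hb).
  rewrite size_rcons size_iota; apply=> //; first by move=> i j [].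
  by rewrite rcons_uniq iota_uniq mem_iota andbT; lia.
- have Hb := @member_survives e [:: x; a.+1; 0] Ha.
  have := family (fun j => [:: x; a.+1; j]) _ _ (fun j => Hb).
  by rewrite size_iota; apply=> //; [move=> i j [] | apply: iota_uniq].
Qed.
End Coding.

Lemma cmp_coded_eq f (X : countType) (e u v : X -> nat) : cmp f -> cmp e -> cmp u -> cmp v ->
  cmp (fun x => coded_eq f (e x) (u x) (v x)).
Proof.
move=> cf ce cu cv.
apply: (cmp_comp (f := fun p : nat * (nat * nat) => coded_eq f p.1 p.2.1 p.2.2)
  (g := fun x => (e x, (u x, v x)))); last by cmp_tac.
rewrite /coded_eq /in_class /member /survives; cmp_tac; apply: (cmp_comp cf); cmp_tac.
Qed.

Lemma Sig2_reduction (Q : nat * nat -> Prop) : Sig2 Q -> exists g : nat -> nat,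
  [/\ cmp g, forall e, E0_field (g e) &
      forall e e', (forall x, Q (e, x) <-> Q (e', x)) <-> E0_iso (g e) (g e')].
Proof.
move=> [f cf Hf].
have [|g cg Hg] := @smn (fun p => coded_eq f p.1 (cfst p.2) (csnd p.2)).
  by apply: cmp_nat_of_bool; apply: cmp_coded_eq => //; rewrite /csnd /cfst; cmp_tac.
have {}Hg e x y : phi (g e) (cpair x y) (coded_eq f e x y).
  by have /= := Hg e (cpair x y); rewrite cfstK csndK.
have Eg e x y : eqstr (g e) x y <-> coded_eq f e x y.
  split=> [H|H]; last by have := Hg e x y; rewrite H.
  by have := phi_functional H (Hg e x y); case: coded_eq.
have Qg e e' : (forall x, Q (e, x) <-> Q (e', x)) ->
    forall n k, 0 < n -> has_classes (coded_eq f e) n k -> has_classes (coded_eq f e') n k.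
  move=> H n k n0; rewrite !has_classes_coded //; case=> [?|?|?|[x En Hx]].
  - by constructor 1.
  - by constructor 2.
  - by constructor 3.
  - by constructor 4; exists x => //; apply/(Hf (e', x)); apply/H; apply/(Hf (e, x)).
have Eh e n k : has_classes (eqstr (g e)) n k <-> has_classes (coded_eq f e) n k.
  by split; apply: has_classes_ext => x y; rewrite Eg.
have gQ e e' : E0_iso (g e) (g e') -> forall x, Q (e, x) -> Q (e', x).
  move=> H x /Hf HQ; have n0 : 0 < (x + x).+2 by [].
  have : has_classes (coded_eq f e) (x + x).+2 1.
    by apply/has_classes_coded => //; constructor 4; exists x.
  (* A positive even size is neither 1 nor of the form 2y + 3, so only the case with a witness
     survives. *)
  move=> /Eh /(isomorphic_has_classes n0 H) /Eh /has_classes_coded [] //.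
    by move=> [y]; lia.
  by move=> [y Hy Hb]; apply/Hf; have -> : x = y by lia.
have fg e : E0_field (g e).
  have [Er [Es Et]] := coded_eq_equiv f e; split.
    by move=> x y; have := Hg e x y; case: coded_eq; [right | left].
  split; last by move=> x; have [s Hs] := coded_eq_finite f e x; exists s => y /Eg /Hs.
  split; first by move=> x; apply/Eg.
  split; first by move=> x y /Eg H; apply/Eg; apply: Es.
  by move=> x y z /Eg H1 /Eg H2; apply/Eg; apply: Et H1 H2.
exists g; split=> // e e'; split=> [H|H x]; last first.
  by split; apply: gQ => //; apply: isomorphic_sym.
have [_ [eq1 fin1]] := fg e; have [_ [eq2 fin2]] := fg e'.
apply: has_classes_isomorphic => // n k n0; rewrite !Eh.
by split; apply: Qg => // x; rewrite H.
Qed.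

Lemma E1_reduction : c_reducible (fun _ => True) E1_eq E0_field E0_iso.
Proof.
have [g [/cmp_phi cg fg Hg]] := Sig2_reduction Sig2_W'.
by exists g; split=> //; split=> // x y _ _; rewrite -Hg.
Qed.

(** * Finitary completeness *)

Section Paths.
Variables (xs : seq nat) (S : nat * nat * nat -> Prop).

(* The graph G_a of the proof idea. *)
Definition edge (a p q : nat) : Prop :=
  forall i, i \in iota 0 a.+1 -> S ((nth 0 xs p, nth 0 xs q), i).

(** w lists the vertices after k, so the empty list is the trivial path from k to itself. *)
Definition path_to (a k i : nat) (w : seq nat) : Prop :=
  (all (fun p => p < size xs) w && (last k w == i)) /\
  forall j, j \in iota 0 (size w) -> edge a (nth 0 (k :: w) j) (nth 0 (k :: w) j.+1).

Lemma path_to_cons a k l i w : l < size xs -> edge a k l -> path_to a l i w ->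
  path_to a k i (l :: w).
Proof.
move=> lt Hkl [/andP[H1 H2] H3]; split; first by rewrite /= lt H1.
move=> [|j] //; rewrite mem_iota => Hj; have := H3 j.
by rewrite mem_iota; apply.
Qed.

Lemma path_to_rel (R : nat -> nat -> Prop) a k i w : is_equiv_rel R -> k < size xs ->
  (forall p q, p < size xs -> q < size xs -> edge a p q -> R (nth 0 xs p) (nth 0 xs q)) ->
  path_to a k i w -> R (nth 0 xs k) (nth 0 xs i).
Proof.
move=> [Rr [Rs Rt]] + HR; elim: w k => [|l w IH] k lk.
  by move=> [/eqP <- _].
move=> [/andP[/= /andP[ll H1] H2] H3]; apply: (Rt _ (nth 0 xs l)).
  by apply: HR => //; exact: (H3 0 (mem_head _ _)).
apply: IH => //; split; first by rewrite H1.
move=> j; rewrite mem_iota => Hj; have := H3 j.+1.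
by rewrite inE mem_iota; apply.
Qed.

(** Each unrelated pair of indices is refuted at some a. Edges only disappear as a grows, so the
    maximum over the finitely many pairs serves for all. *)
Lemma edge_eventually (R : nat -> nat -> Prop) :
  (forall x y, R x y <-> forall a, S ((x, y), a)) ->
  exists a, forall p q, p < size xs -> q < size xs -> edge a p q -> R (nth 0 xs p) (nth 0 xs q).
Proof.
move=> HR.
have /choice [h Hh] : forall pq : nat * nat, exists a,
    edge a pq.1 pq.2 -> R (nth 0 xs pq.1) (nth 0 xs pq.2).
  move=> [p q] /=; have [H|nR] := EM (R (nth 0 xs p) (nth 0 xs q)); first by exists 0.
  have /existsNP [a Ha] : ~ forall a, S ((nth 0 xs p, nth 0 xs q), a) by move=> /HR.
  exists a => He; case: Ha; apply: He.
  by rewrite mem_iota ltnS /=.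
exists (\max_(pq : 'I_(size xs) * 'I_(size xs)) h (val pq.1, val pq.2)) => p q lp lq He.
apply: (Hh (p, q)) => i; rewrite mem_iota ltnS => /= Hi; apply: He.
rewrite mem_iota ltnS /=; apply: leq_trans Hi _.
exact: (@leq_bigmax _ (fun pq : 'I_(size xs) * 'I_(size xs) => h (val pq.1, val pq.2))
  (Ordinal lp, Ordinal lq)).
Qed.
End Paths.

Lemma Pi03_fin_reducible (R : nat -> nat -> Prop) : is_equiv_rel R -> Pi03_rel R ->
  fin_reducible (fun _ => True) R E0_field E0_iso.
Proof.
move=> eR /Pi03_relP [S HS ES].
have {}ES x y : R x y <-> forall a, S ((x, y), a) by rewrite (ES (x, y)).
(* The first component codes the index k followed by the tuple, the second codes the pair of a
   target i and a stage a. *)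
pose Q (p : nat * nat) := exists w, path_to (behead (CodeSeq.decode p.1)) S
  (nth 0 (CodeSeq.decode p.2) 1) (head 0 (CodeSeq.decode p.1)) (nth 0 (CodeSeq.decode p.2) 0)
  (CodeSeq.decode w).
have HQ : Sig2 Q.
  apply: (Sig2_exists (Q := fun q : nat * nat * nat =>
    path_to (behead (CodeSeq.decode q.1.1)) S
    (nth 0 (CodeSeq.decode q.1.2) 1) (head 0 (CodeSeq.decode q.1.1))
    (nth 0 (CodeSeq.decode q.1.2) 0) (CodeSeq.decode q.2))).
  apply: Sig2_and; first by apply: Sig2_dec; cmp_tac.
  apply: (Sig2_all 0 (Q := fun q : nat * nat * nat * nat =>
    edge (behead (CodeSeq.decode q.1.1.1)) S
    (nth 0 (CodeSeq.decode q.1.1.2) 1)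
    (nth 0 (head 0 (CodeSeq.decode q.1.1.1) :: CodeSeq.decode q.1.2) q.2)
    (nth 0 (head 0 (CodeSeq.decode q.1.1.1) :: CodeSeq.decode q.1.2) q.2.+1))); last by cmp_tac.
  apply: (Sig2_all 0 (Q := fun q : nat * nat * nat * nat * nat =>
    S ((nth 0 (behead (CodeSeq.decode q.1.1.1.1))
          (nth 0 (head 0 (CodeSeq.decode q.1.1.1.1) :: CodeSeq.decode q.1.1.2) q.1.2),
        nth 0 (behead (CodeSeq.decode q.1.1.1.1))
          (nth 0 (head 0 (CodeSeq.decode q.1.1.1.1) :: CodeSeq.decode q.1.1.2) q.1.2.+1)), q.2)));
    last by cmp_tac.
  by apply: (Sig2_comp HS); cmp_tac.
have [g [cg fg Hg]] := Sig2_reduction HQ.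
have /cmp_phi [e He] : cmp (fun xs : seq nat =>
    [seq g (CodeSeq.code (k :: xs)) | k <- iota 0 (size xs)]).
  by cmp_tac; apply: (cmp_comp cg); cmp_tac.
exists e => xs _ _; exists [seq g (CodeSeq.code (k :: xs)) | k <- iota 0 (size xs)].
split; first exact: He.
split; first by rewrite size_map size_iota.
split; first by move=> y /mapP [k _ ->].
have QE k z : Q (CodeSeq.code (k :: xs), z) <-> exists w,
    path_to xs S (nth 0 (CodeSeq.decode z) 1) k (nth 0 (CodeSeq.decode z) 0) w.
  rewrite /Q; cbn [fst snd]; rewrite CodeSeq.codeK; split=> [[w Hw]|[w Hw]].
    by exists (CodeSeq.decode w).
  by exists (CodeSeq.code w); rewrite CodeSeq.codeK.
(* Related indices are adjacent at every stage, so a path from l extends to one from k. *)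
have RQ k l z : k < size xs -> l < size xs -> R (nth 0 xs k) (nth 0 xs l) ->
    Q (CodeSeq.code (l :: xs), z) -> Q (CodeSeq.code (k :: xs), z).
  move=> lk ll HR /QE [w Hw]; apply/QE; exists (l :: w).
  by apply: path_to_cons => // a _; apply: (ES _ _).1.
move=> i j /andP[lij lj]; have li := ltn_trans lij lj.
rewrite !(nth_map 0) ?size_iota // !nth_iota // !add0n -Hg; split=> [HR z|H].
  by split; apply: RQ => //; have [_ [Rs _]] := eR; apply: Rs.
have [a Ha] := edge_eventually xs ES.
(* The trivial path puts (i, a) into the set of i, hence into that of j; the resulting path from j
   to i runs along edges that imply [R]. *)
have /H /QE [w] : Q (CodeSeq.code (i :: xs), CodeSeq.code [:: i; a]).
  by apply/QE; exists [::]; rewrite CodeSeq.codeK; split=> //=; rewrite eqxx.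
rewrite CodeSeq.codeK => /(path_to_rel eR lj Ha).
by have [_ [Rs _]] := eR; apply: Rs.
Qed.

Theorem theorem4p7 :
  (* E^0_iso (as a set of pairs from its field) is Pi^0_3 *)
  Pi03_rel (fun i j => E0_field i /\ E0_field j /\ E0_iso i j) /\
  (* every Pi^0_3 equivalence relation finitarily reduces to E^0_iso *)
  (forall R : nat -> nat -> Prop, is_equiv_rel R -> Pi03_rel R ->
     fin_reducible (fun _ => True) R E0_field E0_iso) /\
  (* indeed E^1_= <=_c E^0_iso *)
  c_reducible (fun _ => True) E1_eq E0_field E0_iso.
Proof.
split; first exact/Pi03_relP/Pi3_E0_iso.
split; [exact: Pi03_fin_reducible | exact: E1_reduction].
Qed.
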